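(* For every dimension $n$ there exists a constant $A_n$ depending only on $n$ such that the following holds. Let $(M,g)=\mathbb S^n_R$ be the $n$-dimensional sphere of radius $R>0$ with the standard round metric and let $\Omega$ be a domain in $\mathbb S^n_R$ with $C^1$ boundary. Then $$\mu_j\le A_n\left(\frac{j}{|\Omega|}\right)^{\frac4n}$$ for all $j\in\mathbb N$, where $\mu_j$ are the biharmonic Neumann eigenvalues of $\Omega$.
   Context: A domain is a connected open set; $\mathbb N$ is the set of positive integers; $|\Omega|$ is the Riemannian volume. $H^2(\Omega)$ is the completion of $C^\infty(\Omega)$ (functions with finite norm) with respect to $\left(\int_\Omega(|D^2f|^2+|\nabla f|^2+f^2)dv\right)^{1/2}$, with $D^2$ the Hessian and $dv$ the Riemannian volume element. The biharmonic Neumann eigenvalues $\mu_1\le\mu_2\le\cdots$ (repeated with multiplicity) are the eigenvalues of $\int_\Omega(\langle D^2u,D^2\phi\rangle+\mathrm{Ric}(\nabla u,\nabla\phi))dv=\mu\int_\Omega u\phi\,dv$ for all $\phi\in H^2(\Omega)$, with $u\in H^2(\Omega)$, $\mu\in\mathbb R$, that is $$\mu_j=\min_{\substack{U\subset H^2(\Omega)\\ \dim U=j}}\max_{0\ne u\in U}\frac{\int_\Omega(|D^2u|^2+\mathrm{Ric}(\nabla u,\nabla u))dv}{\int_\Omega u^2dv}.$$ *)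

(* Defs.v *)
From HB Require Import structures.
From mathcomp Require Import all_boot all_order all_algebra.
From mathcomp Require Import all_classical all_reals all_analysis.
Set Implicit Arguments.
Unset Strict Implicit.
Unset Printing Implicit Defensive.
Import Order.TTheory GRing.Theory Num.Theory.
Import numFieldNormedType.Exports.
Local Open Scope classical_set_scope.
Local Open Scope ring_scope.

Definition tuple_cons (T : Type) (n : nat) (p : T * n.-tuple T) :
    n.+1.-tuple T :=
  [tuple of p.1 :: p.2].

Lemma measurable_tuple_cons (d : measure_display) (T : measurableType d)
    (n : nat) :
  measurable_fun [set: T * n.-tuple T] (@tuple_cons T n).
Proof. exact: (measurable_cons measurable_fst measurable_snd). Qed.

Lemma sigma_finite_product (d1 d2 : measure_display) (T1 : measurableType d1)
    (T2 : measurableType d2) (R : realType)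
    (m1 : {sigma_finite_measure set T1 -> \bar R})
    (m2 : {sigma_finite_measure set T2 -> \bar R}) :
  sigma_finite setT (m1 \x m2)%E.
Proof.
have /sigma_finiteP[F [TF ndF Foo]] := sigma_finiteT m1.
have /sigma_finiteP[G [TG ndG Goo]] := sigma_finiteT m2.
exists (fun k => F k `*` G k).
  rewrite -setXTT TF TG predeqE => -[x y]; split.
    move=> [/= [k _ Fkx] [l _ Gly]]; exists (maxn k l) => //; split.
    - by move: x Fkx; exact/subsetPset/ndF/leq_maxl.
    - by move: y Gly; exact/subsetPset/ndG/leq_maxr.
  by move=> [k _ []/= ? ?]; split; exists k.
move=> k; have [mF Fk] := Foo k; have [mG Gk] := Goo k.
split; first exact: measurableX.
by rewrite product_measure1E// lte_mul_pinfty// ge0_fin_numE.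
Qed.

Section product_step.
Local Open Scope ereal_scope.
Context (d : measure_display) (T : measurableType d) (R : realType) (n : nat).
Context (m : {sigma_finite_measure set T -> \bar R}).
Context (mu : {sigma_finite_measure set (n.-tuple T) -> \bar R}).

Definition measure_cons : set (n.+1.-tuple T) -> \bar R :=
  pushforward (m \x mu) (@tuple_cons T n).

Let measure_cons0 : measure_cons set0 = 0.
Proof. by rewrite /measure_cons /pushforward preimage_set0 measure0. Qed.

Let measure_cons_ge0 A : 0 <= measure_cons A.
Proof. by rewrite /measure_cons /pushforward; apply: measure_ge0. Qed.

Let measure_cons_sigma_additive : semi_sigma_additive measure_cons.
Proof.
move=> F mF tF mUF.
have mpre A : measurable A -> measurable (@tuple_cons T n @^-1` A).
  by move=> mA; rewrite -[X in measurable X]setTI; exact: measurable_tuple_cons.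
rewrite /measure_cons /pushforward preimage_bigcup.
apply: measure_semi_sigma_additive.
- by move=> k; exact: mpre.
- apply/trivIsetP => /= i j _ _ ij; rewrite -preimage_setI.
  by move/trivIsetP : tF => /(_ _ _ _ _ ij) ->//; rewrite preimage_set0.
- by rewrite -preimage_bigcup; exact: mpre.
Qed.

HB.instance Definition _ := isMeasure.Build _ _ _ measure_cons
  measure_cons0 measure_cons_ge0 measure_cons_sigma_additive.

Let measure_cons_sigma_finite : sigma_finite setT measure_cons.
Proof.
have [F TF Foo] := sigma_finite_product m mu.
pose uncons (t : n.+1.-tuple T) := (thead t, [tuple of behead t]).
have unconsK : cancel (@tuple_cons T n) uncons.
  by move=> [x t]; congr pair; apply/val_inj.
have muncons : measurable_fun setT uncons.
  apply: measurable_fun_pair; first exact: measurable_tnth.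
  exact: measurable_behead.
exists (fun k => uncons @^-1` F k).
  by rewrite -preimage_bigcup -TF preimage_setT.
move=> k; have [mF Fk] := Foo k; split.
  by rewrite -[X in measurable X]setTI; exact: muncons.
rewrite /measure_cons /pushforward -comp_preimage.
by rewrite (_ : uncons \o _ = id)//; apply/funext => p; exact: unconsK.
Qed.

HB.instance Definition _ := Measure_isSigmaFinite.Build _ _ _ measure_cons
  measure_cons_sigma_finite.

End product_step.

(* The [n]-fold product of a sigma-finite measure. *)
Fixpoint measure_power (d : measure_display) (T : measurableType d)
    (R : realType) (m : {sigma_finite_measure set T -> \bar R}) (n : nat) :
    {sigma_finite_measure set (n.-tuple T) -> \bar R} :=
  match n with
  | 0 => @dirac _ (0.-tuple T) [tuple] R
  | k.+1 => measure_cons m (measure_power m k)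
  end.

Definition lebesgueRn (R : realType) (n : nat) :=
  measure_power (@lebesgue_measure R) n.

Definition rv_of_tuple (R : realType) (n : nat)
    (t : n.-tuple (measurableTypeR R)) : 'rV[R]_n :=
  \row_i tnth t i.

(* The norm of 'rV[R]_n in the library is the sup norm; lengths are measured
   with the Euclidean norm below (both induce the same topology). *)
Definition dot (R : realType) (n : nat) (u v : 'rV[R]_n) : R :=
  \sum_i u 0 i * v 0 i.

Definition enorm (R : realType) (n : nat) (u : 'rV[R]_n) : R :=
  Num.sqrt (dot u u).

Fixpoint Ck (R : realType) (V W : normedModType R) (k : nat) (D : set V)
    (f : V -> W) : Prop :=
  (forall x, D x -> {for x, continuous f}) /\
  match k with
  | 0 => True
  | k'.+1 => (forall x v, D x -> derivable f x v) /\
             (forall v, Ck k' D (fun x => 'D_v f x))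
  end.

Definition Cinfty (R : realType) (V W : normedModType R) (D : set V)
    (f : V -> W) : Prop :=
  forall k, Ck k D f.

(* The n-dimensional sphere S^n_r of radius r is realised as the submanifold
   |x| = r of R^(n+1), with the metric induced by [dot]. Functions and vector
   fields on (a subset of) S^n_r are maps on R^(n+1) of which only the values
   on the sphere matter: every operator below first replaces them by the
   extension that is constant along rays. *)
Definition sphere (R : realType) (n : nat) (r : R) : set 'rV[R]_n.+1 :=
  [set x | enorm x = r].

Definition ray_proj (R : realType) (n : nat) (r : R) (x : 'rV[R]_n.+1) :
    'rV[R]_n.+1 :=
  (r / enorm x) *: x.

Definition ray (R : realType) (n : nat) (W : Type) (r : R)
    (f : 'rV[R]_n.+1 -> W) : 'rV[R]_n.+1 -> W :=
  fun x => f (ray_proj r x).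

Definition cone (R : realType) (n : nat) (r : R) (Omega : set 'rV[R]_n.+1) :
    set 'rV[R]_n.+1 :=
  [set x | x != 0 /\ Omega (ray_proj r x)].

(* u is smooth on the relatively open subset Omega of the sphere. *)
Definition smooth (R : realType) (n : nat) (r : R) (Omega : set 'rV[R]_n.+1)
    (u : 'rV[R]_n.+1 -> R) : Prop :=
  Cinfty (cone r Omega) (ray r u : _ -> R^o).

(* Orthogonal projection onto the tangent space of the sphere at x. *)
Definition tproj (R : realType) (n : nat) (x v : 'rV[R]_n.+1) : 'rV[R]_n.+1 :=
  v - (dot v x / dot x x) *: x.

(* Tangential projections of the standard basis: for a bilinear form B on the
   tangent space T_x, the sum over i of B (tframe x i) (tframe x i) is the
   trace of B. *)
Definition tframe (R : realType) (n : nat) (x : 'rV[R]_n.+1) (i : 'I_n.+1) :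
    'rV[R]_n.+1 :=
  tproj x (delta_mx 0 i).

Definition grad (R : realType) (n : nat) (r : R) (u : 'rV[R]_n.+1 -> R)
    (x : 'rV[R]_n.+1) : 'rV[R]_n.+1 :=
  tproj x (\row_i 'D_(delta_mx 0 i) (ray r u : _ -> R^o) x).

(* Levi-Civita connection of the induced metric: tangential part of the
   Euclidean derivative of the field Y at x in the direction v. *)
Definition nabla (R : realType) (n : nat) (r : R) (v : 'rV[R]_n.+1)
    (Y : 'rV[R]_n.+1 -> 'rV[R]_n.+1) (x : 'rV[R]_n.+1) : 'rV[R]_n.+1 :=
  tproj x ('D_v (ray r Y) x).

Definition hess (R : realType) (n : nat) (r : R) (u : 'rV[R]_n.+1 -> R)
    (x v w : 'rV[R]_n.+1) : R :=
  dot (nabla r v (grad r u) x) w.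

Definition hess_normsq (R : realType) (n : nat) (r : R)
    (u : 'rV[R]_n.+1 -> R) (x : 'rV[R]_n.+1) : R :=
  \sum_i \sum_j hess r u x (tframe x i) (tframe x j) ^+ 2.

Definition lie (R : realType) (n : nat) (r : R)
    (X Y : 'rV[R]_n.+1 -> 'rV[R]_n.+1) (x : 'rV[R]_n.+1) : 'rV[R]_n.+1 :=
  'D_(X x) (ray r Y) x - 'D_(Y x) (ray r X) x.

(* R(X,Y)Z = nabla_X nabla_Y Z - nabla_Y nabla_X Z - nabla_[X,Y] Z *)
Definition curv (R : realType) (n : nat) (r : R)
    (X Y Z : 'rV[R]_n.+1 -> 'rV[R]_n.+1) (x : 'rV[R]_n.+1) : 'rV[R]_n.+1 :=
  nabla r (X x) (fun y => nabla r (Y y) Z y) x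
  - nabla r (Y x) (fun y => nabla r (X y) Z y) x
  - nabla r (lie r X Y x) Z x.

(* Ric(v, w) is the trace of e |-> R(e, v)w; tangent vectors at x are extended
   to the tangent fields y |-> tproj y v. *)
Definition ric (R : realType) (n : nat) (r : R) (x v w : 'rV[R]_n.+1) : R :=
  \sum_i dot (curv r (fun y => tframe y i) (fun y => tproj y v)
                  (fun y => tproj y w) x)
             (tframe x i).

(* Inverse stereographic projection R^n -> S^n_r from the point whose first
   coordinate is -r (s = false) or r (s = true). The two images of the open
   unit ball are the open hemispheres, which cover the sphere up to the
   equator. *)
Definition stereo (R : realType) (n : nat) (r : R) (s : bool) (y : 'rV[R]_n) :
    'rV[R]_n.+1 :=
  (r / (1 + dot y y)) *:
    (row_mx ((-1) ^+ s * (1 - dot y y))%:M (2 *: y) : 'rV[R]_(1 + n)).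

(* sqrt (det g) for the metric g pulled back by the chart. *)
Definition vol_density (R : realType) (n : nat) (r : R) (s : bool)
    (y : 'rV[R]_n) : R :=
  let J := jacobian (@stereo R n r s) y in Num.sqrt (\det (J *m J^T)).

(* The part of the chart domain that the chart maps into Omega. *)
Definition chart_dom (R : realType) (n : nat) (r : R)
    (Omega : set 'rV[R]_n.+1) (s : bool) :
    set (n.-tuple (measurableTypeR R)) :=
  [set t | enorm (rv_of_tuple t) < 1 /\ Omega (stereo r s (rv_of_tuple t))].

(* Integral over Omega with respect to the Riemannian volume of S^n_r. *)
Definition sphere_int (R : realType) (n : nat) (r : R)
    (Omega : set 'rV[R]_n.+1) (f : 'rV[R]_n.+1 -> R) : \bar R :=
  (\sum_(s : bool) \int[lebesgueRn R n]_(t in chart_dom r Omega s)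
    (f (stereo r s (rv_of_tuple t)) * vol_density r s (rv_of_tuple t))%:E)%E.

Definition volume (R : realType) (n : nat) (r : R) (Omega : set 'rV[R]_n.+1) :
    R :=
  fine (sphere_int r Omega (fun=> 1)).

Definition h2_normsq (R : realType) (n : nat) (r : R)
    (Omega : set 'rV[R]_n.+1) (u : 'rV[R]_n.+1 -> R) : \bar R :=
  sphere_int r Omega (fun x =>
    hess_normsq r u x + dot (grad r u x) (grad r u x) + u x ^+ 2).

Definition h2_norm (R : realType) (n : nat) (r : R)
    (Omega : set 'rV[R]_n.+1) (u : 'rV[R]_n.+1 -> R) : R :=
  Num.sqrt (fine (h2_normsq r Omega u)).

Definition h2_smooth (R : realType) (n : nat) (r : R)
    (Omega : set 'rV[R]_n.+1) (u : 'rV[R]_n.+1 -> R) : Prop :=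
  smooth r Omega u /\ (h2_normsq r Omega u < +oo)%E.

(* H^2(Omega), the completion of the smooth functions of finite norm: its
   elements are represented by the Cauchy sequences of such functions, and two
   Cauchy sequences represent the same element when the norm of their
   difference, in the sense of [H2_norm], vanishes. *)
Definition H2 (R : realType) (n : nat) (r : R) (Omega : set 'rV[R]_n.+1) :
    set (nat -> 'rV[R]_n.+1 -> R) :=
  [set u | (forall k, h2_smooth r Omega (u k)) /\
    forall e : R, 0 < e -> exists N : nat, forall k l,
      (N <= k)%N -> (N <= l)%N ->
      h2_norm r Omega (fun x => u k x - u l x) < e].

Definition H2_norm (R : realType) (n : nat) (r : R) (Omega : set 'rV[R]_n.+1)
    (u : nat -> 'rV[R]_n.+1 -> R) : R :=
  limn (fun k => h2_norm r Omega (u k)).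

Definition lincomb (R : realType) (n j : nat) (c : 'I_j -> R)
    (U : 'I_j -> nat -> 'rV[R]_n.+1 -> R) : nat -> 'rV[R]_n.+1 -> R :=
  fun k x => \sum_i c i * U i k x.

(* U is a basis of a j-dimensional subspace of H^2(Omega). *)
Definition H2_free (R : realType) (n j : nat) (r : R)
    (Omega : set 'rV[R]_n.+1) (U : 'I_j -> nat -> 'rV[R]_n.+1 -> R) : Prop :=
  (forall i, H2 r Omega (U i)) /\
  forall c : 'I_j -> R, H2_norm r Omega (lincomb c U) = 0 ->
    forall i, c i = 0.

(* The quadratic forms of the Rayleigh quotient are continuous for the H^2
   norm, hence extend to the completion by taking limits. *)
Definition energy (R : realType) (n : nat) (r : R) (Omega : set 'rV[R]_n.+1)
    (u : nat -> 'rV[R]_n.+1 -> R) : R :=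
  limn (fun k => fine (sphere_int r Omega (fun x =>
    hess_normsq r (u k) x + ric r x (grad r (u k) x) (grad r (u k) x)))).

Definition mass (R : realType) (n : nat) (r : R) (Omega : set 'rV[R]_n.+1)
    (u : nat -> 'rV[R]_n.+1 -> R) : R :=
  limn (fun k => fine (sphere_int r Omega (fun x => u k x ^+ 2))).

(* The j-th biharmonic Neumann eigenvalue, for j >= 1. H^2(Omega) embeds in
   L^2(Omega), so that [mass] does not vanish on non-zero elements. *)
Definition neumann_mu (R : realType) (n : nat) (r : R)
    (Omega : set 'rV[R]_n.+1) (j : nat) : \bar R :=
  ereal_inf [set m | exists2 U : 'I_j -> nat -> 'rV[R]_n.+1 -> R,
    H2_free r Omega U &
    m = ereal_sup [set q | exists2 c : 'I_j -> R,
          exists i, c i != 0 &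
          q = (energy r Omega (lincomb c U) /
               mass r Omega (lincomb c U))%:E]].

Definition domain (R : realType) (n : nat) (r : R)
    (Omega : set 'rV[R]_n.+1) : Prop :=
  [/\ Omega !=set0, connected Omega &
      exists2 O : set 'rV[R]_n.+1, open O & Omega = sphere r `&` O].

(* Near each boundary point p, Omega is the sublevel set {rho < 0} of a C^1
   function rho that vanishes at p and whose tangential gradient at p is not
   zero. The boundary of Omega in the sphere is closure Omega `\` Omega, since
   Omega is open in the sphere and the sphere is closed. *)
Definition C1_boundary (R : realType) (n : nat) (r : R)
    (Omega : set 'rV[R]_n.+1) : Prop :=
  forall p, (closure Omega `\` Omega) p ->
    exists (O : set 'rV[R]_n.+1) (rho : 'rV[R]_n.+1 -> R^o),
      [/\ open O, O p, Ck 1 O rho &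
      [/\ rho p = 0,
          tproj p (\row_i 'D_(delta_mx 0 i) rho p) != 0 &
          Omega `&` O = [set x | [/\ sphere r x, O x & rho x < 0]]]].

(* Main.v *)
Require Import Defs.
From mathcomp Require Import all_boot all_order all_algebra.
From mathcomp Require Import all_classical all_reals all_analysis.
From mathcomp Require Import measurable_realfun.
From mathcomp Require Import ring lra.
Set Implicit Arguments.
Unset Strict Implicit.
Unset Printing Implicit Defensive.
Import Order.TTheory GRing.Theory Num.Theory.
Import numFieldNormedType.Exports.
Local Open Scope classical_set_scope.
Local Open Scope ring_scope.

(** The eigenvalue is bounded by the min-max formula: it suffices to exhibit [j]
    independent functions on whose span the Rayleigh quotient is small. They
    are smooth cutoffs of a small size [delta], with pairwise disjoint
    supports, centred at points of a cubic grid of side [delta] in R^(n+1).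

    Energy of one cutoff. The cutoff is [e exp(-1/q)], with
    [q = n + 2 - |x - p|^2 / delta^2], extended by 0 where [q <= 0]. On the
    sphere it is a function of the inner product [p . x] alone, so its gradient
    and its Hessian are explicit ([grad_cutoff], [hess_cutoff]); both rest on
    the identity [nabla_v (tproj . w) = - (w . x) / |x|^2 tproj_x v]
    ([nabla_tproj]), which also gives the curvature ([curv_tproj]) and the
    upper bound [ric_le] on the Ricci form. When [delta <= r] the energy
    density of a cutoff is at most a constant times [delta^-4] and vanishes off
    its support ([energy_density_le]).

    From supports to cells. Each cutoff is at least 1 on its grid cell, so its
    mass is at least the volume of that cell inside the domain, while its
    energy is at most [C delta^-4] times the volume of its support inside the
    domain. These two volumes are comparable for sufficiently many cells. Colour
    the cells by their indices modulo [2 (n + 2)]: supports of one colour are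
    disjoint, so their volumes add up to at most [V], the volume of the domain.
    One colour carries a fixed fraction of [V], and the cells of that colour
    whose support is much heavier than the cell itself account for at most half
    of this ([exists_good_colour]). A cell has volume at most
    [2 (8 delta)^n] ([sphere_int_small]), so at least [c V / delta^n] good
    cells remain. Since the supports are disjoint, energy and mass are diagonal
    in the coefficients of a linear combination, and the Rayleigh quotient on
    the whole span is at most a constant times [delta^-4] ([neumann_mu_le]).

    Choice of scale. Taking [delta^n = c V / j] produces [j] good cells and
    [delta^-4 = C (j / V)^(4 / n)]. The condition [delta <= r] is automatic
    because [V] is at most a constant times [r^n].

    The integral of any function, measurable or not, is at most that of a
    non-negative majorant ([le_integral_ge0r]), and the energy densities are only
    ever bounded from above by combinations of indicators; measurability is thus
    a matter of cells, supports and the domain. The volume itself is computed in the stereographic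
    charts, which are conformal ([vol_density_conf]). *)

Lemma eq_ler (R : numDomainType) (x y : R) : x = y -> x <= y.
Proof. by move->. Qed.

(** * Euclidean algebra and tangent projections *)

Section EuclideanStructure.
Variables (R : realType) (n : nat).
Implicit Types (a : R) (u v w x : 'rV[R]_n).

Lemma dotC u v : dot u v = dot v u.
Proof. by apply: eq_bigr => i _; rewrite mulrC. Qed.

Lemma dotDl u v w : dot (u + v) w = dot u w + dot v w.
Proof. by rewrite -big_split; apply: eq_bigr => i _; rewrite mxE mulrDl. Qed.

Lemma dotZl a u w : dot (a *: u) w = a * dot u w.
Proof. by rewrite /dot mulr_sumr; apply: eq_bigr => i _; rewrite mxE mulrA. Qed.

Lemma dotNl u w : dot (- u) w = - dot u w.
Proof. by rewrite -scaleN1r dotZl mulN1r. Qed.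

Lemma dotBl u v w : dot (u - v) w = dot u w - dot v w.
Proof. by rewrite dotDl dotNl. Qed.

Lemma dot0l w : dot 0 w = 0.
Proof. by rewrite -(scale0r w) dotZl mul0r. Qed.

Lemma dotDr u v w : dot w (u + v) = dot w u + dot w v.
Proof. by rewrite dotC dotDl !(dotC w). Qed.

Lemma dotZr a u w : dot w (a *: u) = a * dot w u.
Proof. by rewrite dotC dotZl (dotC w). Qed.

Lemma dotNr u w : dot w (- u) = - dot w u.
Proof. by rewrite dotC dotNl (dotC w). Qed.

Lemma dotBr u v w : dot w (u - v) = dot w u - dot w v.
Proof. by rewrite dotDr dotNr. Qed.

Lemma dot0r w : dot w 0 = 0.
Proof. by rewrite dotC dot0l. Qed.

Lemma dot_suml (I : finType) (f : I -> 'rV[R]_n) w :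
  dot (\sum_i f i) w = \sum_i dot (f i) w.
Proof.
by elim/big_rec2: _ => [|i a u _ <-]; rewrite ?dot0l ?dotDl.
Qed.

Lemma dot_ge0 u : 0 <= dot u u.
Proof. by apply: sumr_ge0 => i _; rewrite -expr2 sqr_ge0. Qed.

Lemma dot_eq0 u : (dot u u == 0) = (u == 0).
Proof.
apply/idP/eqP => [|->]; last by rewrite dot0l.
rewrite psumr_eq0 => [/allP u0|i _]; last by rewrite -expr2 sqr_ge0.
apply/rowP => i; rewrite mxE; apply/eqP; rewrite -sqrf_eq0 expr2.
by apply: (u0 i); rewrite mem_index_enum.
Qed.

Lemma dot_gt0 u : (0 < dot u u) = (u != 0).
Proof. by rewrite lt_neqAle dot_ge0 andbT eq_sym dot_eq0. Qed.

Lemma dot_deltal (i : 'I_n) v : dot (delta_mx 0 i) v = v 0 i.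
Proof.
rewrite /dot (bigD1 i)//= mxE !eqxx mul1r big1 ?addr0// => j ji.
by rewrite mxE eqxx (negbTE ji) mul0r.
Qed.

Lemma dot_deltar (i : 'I_n) v : dot v (delta_mx 0 i) = v 0 i.
Proof. by rewrite dotC dot_deltal. Qed.

(** The component of [u] orthogonal to [v] has non-negative squared length. *)
Lemma dot_cauchy_schwarz u v : dot u v ^+ 2 <= dot u u * dot v v.
Proof.
have [->|v0] := eqVneq v 0; first by rewrite !dot0r mulr0 expr0n.
have vv : 0 < dot v v by rewrite dot_gt0.
have := dot_ge0 (u - (dot u v / dot v v) *: v).
set p := dot (u - _) _.
have -> : p = (dot u u * dot v v - dot u v ^+ 2) / dot v v.
  by rewrite /p !(dotBl, dotBr, dotZl, dotZr) (dotC v u); field; rewrite gt_eqF.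
by rewrite pmulr_lge0 ?invr_gt0// subr_ge0.
Qed.

End EuclideanStructure.

Section TangentProjection.
Variables (R : realType) (n : nat).
Implicit Types (a : R) (u v w x : 'rV[R]_n.+1).

Lemma dot_tproj_pos x v : x != 0 -> dot (tproj x v) x = 0.
Proof.
by move=> x0; rewrite dotBl dotZl divfK ?subrr// dot_eq0.
Qed.

Lemma tprojZ x a v : tproj x (a *: v) = a *: tproj x v.
Proof. by rewrite /tproj dotZl scalerBr scalerA mulrA. Qed.

Lemma tprojD x u v : tproj x (u + v) = tproj x u + tproj x v.
Proof. by rewrite /tproj dotDl mulrDl scalerDl opprD addrACA. Qed.

Lemma tproj0 x : tproj x 0 = 0.
Proof. by rewrite /tproj dot0l mul0r scale0r subrr. Qed.

Lemma tproj_sum x (I : finType) (f : I -> 'rV[R]_n.+1) :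
  tproj x (\sum_i f i) = \sum_i tproj x (f i).
Proof.
by elim/big_rec2: _ => [|i u v _ <-]; rewrite ?tproj0 ?tprojD.
Qed.

Lemma tproj_pos x : x != 0 -> tproj x x = 0.
Proof. by move=> x0; rewrite /tproj divff ?dot_eq0// scale1r subrr. Qed.

Lemma tproj_id x v : dot v x = 0 -> tproj x v = v.
Proof. by move=> vx; rewrite /tproj vx mul0r scale0r subr0. Qed.

Lemma tprojK x v : x != 0 -> tproj x (tproj x v) = tproj x v.
Proof. by move=> x0; rewrite tproj_id// dot_tproj_pos. Qed.

(** The radial component of either argument is orthogonal to the tangential
    component of the other one. *)
Lemma dot_tprojC x u v : x != 0 -> dot (tproj x u) v = dot u (tproj x v).
Proof.
by move=> x0; rewrite dotBl dotBr dotZl dotZr (dotC x v); ring.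
Qed.

Lemma dot_tproj_tproj x u v : x != 0 ->
  dot (tproj x u) (tproj x v) = dot (tproj x u) v.
Proof. by move=> x0; rewrite dot_tprojC// tprojK// -dot_tprojC. Qed.

Lemma dot_tproj_le x v : x != 0 -> dot (tproj x v) (tproj x v) <= dot v v.
Proof.
move=> x0; rewrite dot_tproj_tproj// dotBl dotZl (dotC x v) gerDl oppr_le0.
by rewrite mulrAC -expr2 divr_ge0 ?sqr_ge0 ?dot_ge0.
Qed.

Lemma dot_tframe_le1 x i : x != 0 -> dot (tframe x i) (tframe x i) <= 1.
Proof.
by move=> x0; apply: (le_trans (dot_tproj_le _ x0)); rewrite dot_deltal mxE !eqxx.
Qed.

Lemma tprojZl x a v : a != 0 -> tproj (a *: x) v = tproj x v.
Proof.
move=> a0; have [->|x0] := eqVneq x 0; first by rewrite scaler0.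
rewrite /tproj !(dotZl, dotZr) scalerA; congr (_ - _ *: _).
by field; rewrite ?dot_eq0 ?x0 ?a0.
Qed.

Lemma enorm_gt0 x : (0 < enorm x) = (x != 0).
Proof. by rewrite sqrtr_gt0 dot_gt0. Qed.

Lemma sqr_enorm x : enorm x ^+ 2 = dot x x.
Proof. by rewrite sqr_sqrtr// dot_ge0. Qed.

Lemma sphere_dot (r : R) x : 0 < r -> sphere r x -> dot x x = r ^+ 2.
Proof. by move=> r0 <-; rewrite sqr_enorm. Qed.

Lemma sphere_neq0 (r : R) x : 0 < r -> sphere r x -> x != 0.
Proof. by move=> r0 xr; rewrite -enorm_gt0 [enorm x]xr. Qed.

Lemma ray_proj0 (r : R) : ray_proj r (0 : 'rV[R]_n.+1) = 0.
Proof. by rewrite /ray_proj scaler0. Qed.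

Lemma ray_proj_id (r : R) x : 0 < r -> sphere r x -> ray_proj r x = x.
Proof.
by move=> r0 xr; rewrite /ray_proj [enorm x]xr divff ?scale1r// gt_eqF.
Qed.

Lemma sphere_ray_proj (r : R) x : 0 < r -> x != 0 -> sphere r (ray_proj r x).
Proof.
move=> r0 x0; have e0 : 0 < enorm x by rewrite enorm_gt0.
have q0 : 0 <= r / enorm x by rewrite divr_ge0 ?ltW.
rewrite /sphere /= {1}/enorm /ray_proj dotZl dotZr mulrA -expr2.
rewrite sqrtrM ?sqr_ge0// sqrtr_sqr ger0_norm//.
by rewrite -/(enorm x) divfK ?gt_eqF.
Qed.

Lemma ray_tproj (r : R) v : 0 < r ->
  ray r (fun y => tproj y v) = fun y => tproj y v.
Proof.
move=> r0; apply/funext => x; rewrite /ray.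
have [->|x0] := eqVneq x 0; first by rewrite ray_proj0.
by rewrite tprojZl// mulf_neq0 ?invr_neq0 ?gt_eqF ?enorm_gt0.
Qed.

End TangentProjection.

(** * Directional derivatives *)

Section DirectionalDerivatives.
Variables (R : realType) (V : normedModType R).
Implicit Types (x v : V).

(** Directional derivatives are derivatives of a restriction to a line; this
    carries the one-variable chain rule over to functions of a vector. *)
Lemma is_derive_line (W : normedModType R) (f : V -> W) x v (df : W) :
  is_derive x v f df <-> is_derive (0 : R) 1 (fun h : R => f (h *: v + x)) df.
Proof.
have E : 'D_v f x = 'D_1 (fun h : R => f (h *: v + x)) 0.
  rewrite /derive; set g1 := fun h => h^-1 *: _; set g2 := fun h => h^-1 *: _.
  suff -> : g1 = g2 by [].
  by apply/funext => h; rewrite /g1 /g2 /= addr0 scale0r add0r [_%:A]mulr1.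
split=> -[fx <-]; split=> //.
- exact: (derivable1P _ _ _).1.
- exact: (derivable1P _ _ _).2.
Qed.

Lemma is_derive_chain (f : V -> R) (g : R -> R) x v (df dg : R) :
  is_derive x v f df -> is_derive (f x) 1 g dg ->
  is_derive x v (g \o f) (dg * df).
Proof.
move=> /is_derive_line fx gx; apply/is_derive_line.
have := @is_derive1_comp _ g (fun h : R => f (h *: v + x)) 0 dg df.
by rewrite scale0r add0r; apply.
Qed.

Lemma is_derive_ext (W : normedModType R) (f g : V -> W) x v (df dg : W) :
  f =1 g -> df = dg -> is_derive x v f df -> is_derive x v g dg.
Proof. by move=> /funext -> ->. Qed.

Lemma is_derive_mulf (f g : V -> R) x v (df dg : R) :
  is_derive x v f df -> is_derive x v g dg ->
  is_derive x v (fun y => f y * g y) (df * g x + f x * dg).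
Proof.
move=> fx gx; apply: is_derive_ext (is_deriveM fx gx) => //.
by rewrite /GRing.scale /=; ring.
Qed.

Lemma is_derive_mulc (c : R) (f : V -> R) x v (df : R) :
  is_derive x v f df -> is_derive x v (fun y => c * f y) (c * df).
Proof. by move=> fx; apply: is_derive_ext (is_deriveZ c fx). Qed.

Lemma is_derive_inv (f : V -> R) x v (df : R) : f x != 0 ->
  is_derive x v f df -> is_derive x v (fun y => (f y)^-1) (- df / f x ^+ 2).
Proof.
move=> fx0 [fx <-]; split; first exact: derivableV.
by rewrite deriveV// /GRing.scale /= !mulNr mulrC.
Qed.

Lemma is_derive_pow (f : V -> R) (m : nat) x v (df : R) :
  is_derive x v f df ->
  is_derive x v (fun y => f y ^+ m) (m%:R * f x ^+ m.-1 * df).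
Proof.
move=> fx; apply: is_derive_ext (is_deriveX m fx) => //.
by move=> y; rewrite exprfctE.
Qed.

Lemma is_derive_row (n : nat) (F : V -> 'rV[R]_n) x v (dF : 'rV[R]_n) :
  (forall i, is_derive x v (fun y => F y 0 i : R) (dF 0 i)) ->
  is_derive x v F dF.
Proof.
move=> Fi; have dFx : derivable F x v.
  by apply/derivable_mxP => i j; rewrite ord1; case: (Fi j).
split=> //; rewrite derive_mx//; apply/rowP => j; rewrite mxE.
by case: (Fi j).
Qed.

Lemma is_derive_coord (n : nat) (F : V -> 'rV[R]_n) x v (dF : 'rV[R]_n) i :
  is_derive x v F dF -> is_derive x v (fun y => F y 0 i : R) (dF 0 i).
Proof.
move=> [Fx <-]; rewrite derive_mx// mxE; split=> //.
by move/derivable_mxP : Fx; apply.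
Qed.

Lemma is_derive_scale (n : nat) (a : V -> R) (F : V -> 'rV[R]_n) x v
    (da : R) (dF : 'rV[R]_n) :
  is_derive x v a da -> is_derive x v F dF ->
  is_derive x v (fun y => a y *: F y) (da *: F x + a x *: dF).
Proof.
move=> ax Fx; apply: is_derive_row => i.
have Fi := is_derive_coord i Fx.
apply: (is_derive_ext _ _ (is_deriveM ax Fi)).
  by move=> y; rewrite mxE.
by rewrite !mxE /GRing.scale /= addrC; congr (_ + _); rewrite mulrC.
Qed.

End DirectionalDerivatives.

Section DerivativesOfDot.
Variables (R : realType) (n : nat).
Implicit Types (p v w x : 'rV[R]_n).

Lemma is_derive_entry x v i : is_derive x v (fun y : 'rV[R]_n => y 0 i : R) (v 0 i).
Proof. exact: (is_derive_coord i (is_derive_id x v)). Qed.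

Lemma is_derive_dotr p x v : is_derive x v (fun y => dot p y : R) (dot p v).
Proof.
have H i := is_deriveZ (p 0 i) (is_derive_entry x v i).
apply: (is_derive_ext _ _ (is_derive_sum H)) => //.
by move=> y; rewrite /dot fct_sumE.
Qed.

Lemma is_derive_dotxx x v : is_derive x v (fun y => dot y y : R) (2 * dot x v).
Proof.
have H i := is_deriveM (is_derive_entry x v i) (is_derive_entry x v i).
apply: (is_derive_ext _ _ (is_derive_sum H)).
  by move=> y; rewrite /dot fct_sumE.
rewrite /dot mulr_sumr; apply: eq_bigr => i _.
by rewrite /GRing.scale /=; ring.
Qed.

End DerivativesOfDot.

Section DerivativesOfNorm.
Variables (R : realType) (n : nat).
Implicit Types (v x : 'rV[R]_n.+1).

Lemma is_derive_enorm x v : x != 0 ->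
  is_derive x v (fun y => enorm y : R) (dot x v / enorm x).
Proof.
move=> x0; have xx : 0 < dot x x by rewrite dot_gt0.
have := is_derive_chain (is_derive_dotxx x v) (is_derive1_sqrt xx).
apply: is_derive_ext => //.
rewrite -/(enorm x) invfM; field.
by rewrite gt_eqF// enorm_gt0.
Qed.

Lemma is_derive_inv_enorm x v : x != 0 ->
  is_derive x v (fun y => (enorm y)^-1 : R) (- dot x v / enorm x ^+ 3).
Proof.
move=> x0; have e0 : enorm x != 0 by rewrite gt_eqF// enorm_gt0.
apply: (is_derive_ext _ _ (is_derive_inv e0 (is_derive_enorm v x0))) => //.
by field.
Qed.

End DerivativesOfNorm.

(** * Covariant derivatives of projected constant fields, and curvature *)

Section TangentFields.
Variables (R : realType) (n : nat).
Implicit Types (p v w x : 'rV[R]_n.+1) (r : R).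

Lemma near_neq0 x : x != 0 -> \forall y \near x, y != 0.
Proof.
move=> x0; have H := @cvgr_neq0 R _ _ (nbhs x) _ id x.
by apply: H => //; exact: cvg_id.
Qed.

Lemma is_derive_near_neq0 (W : normedModType R) (f g : 'rV[R]_n.+1 -> W) x v
    (df : W) : x != 0 -> (forall y, y != 0 -> f y = g y) ->
  is_derive x v f df -> is_derive x v g df.
Proof.
move=> x0 fg; apply: near_eq_is_derive.
by apply: filterS (near_neq0 x0) => y; exact: fg.
Qed.

(** The ray extension of [Y] only needs to be known off the origin. *)
Lemma nabla_is_derive r (F Y : 'rV[R]_n.+1 -> 'rV[R]_n.+1) x v d : x != 0 ->
  (forall y, y != 0 -> F y = Y (ray_proj r y)) ->
  is_derive x v F d -> nabla r v Y x = tproj x d.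
Proof.
by move=> x0 FY /(is_derive_near_neq0 x0 FY) [_ Yx]; rewrite /nabla Yx.
Qed.

(** The radial part, with its coefficient [c], is killed by the projection in
    every later use, so its value is left unspecified. *)
Lemma is_derive_tproj x v w : x != 0 ->
  exists c : R, is_derive x v (fun y => tproj y w)
    (c *: x - (dot w x / dot x x) *: v).
Proof.
move=> x0; have xx : dot x x != 0 by rewrite dot_eq0.
have H1 := is_derive_mulf (is_derive_dotr w x v)
  (@is_derive_inv _ _ (fun y => dot y y) x v _ xx (is_derive_dotxx x v)).
have H2 := is_derive_scale H1 (is_derive_id x v).
have H3 := is_deriveB (is_derive_cst w x v) H2.
eexists; apply: (is_derive_ext _ _ H3); first by move=> y.
by rewrite sub0r opprD -scaleNr; congr (_ - _ *: _).
Qed.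

Lemma nabla_tproj r v w x : 0 < r -> x != 0 ->
  nabla r v (fun y => tproj y w) x = - (dot w x / dot x x) *: tproj x v.
Proof.
move=> r0 x0; have [c H] := is_derive_tproj v w x0.
rewrite (nabla_is_derive x0 _ H) => [|y y0]; last first.
  by rewrite -[LHS](congr1 (fun f => f y) (ray_tproj w r0)).
by rewrite tprojD -scaleNr !tprojZ tproj_pos// scaler0 add0r.
Qed.

(** The inner derivative is [- (w . y) / (r |y|)] times the field of [v], and
    the scalar factor vanishes at [x] when [w] is tangent there. *)
Lemma nabla_nabla_tproj r u v w x : 0 < r -> sphere r x -> dot w x = 0 ->
  nabla r u (fun y => nabla r (tproj y v) (fun z => tproj z w) y) x =
  - (dot w u / r ^+ 2) *: tproj x v.
Proof.
move=> r0 xr wx; have x0 := sphere_neq0 r0 xr.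
have [c H] := is_derive_tproj u v x0.
have H1 := is_derive_mulf (is_derive_dotr w x u) (is_derive_inv_enorm u x0).
have H2 := is_derive_scale (is_derive_mulc (- r^-1) H1) H.
rewrite (nabla_is_derive x0 _ H2) => [|y y0]; last first.
  have yr := sphere_ray_proj r0 y0.
  rewrite nabla_tproj ?(sphere_neq0 r0 yr)//.
  rewrite tprojK ?(sphere_neq0 r0 yr)// (sphere_dot r0 yr).
  rewrite tprojZl; last first.
    by rewrite mulf_neq0 ?invr_neq0 ?gt_eqF// enorm_gt0.
  congr (_ *: _); rewrite /ray_proj dotZr /=; field.
  by rewrite !gt_eqF// enorm_gt0.
rewrite wx !(mul0r, mulr0, addr0, scale0r) tprojZ tprojK//; congr (_ *: _).
by rewrite (_ : enorm x = r)//; field; rewrite gt_eqF.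
Qed.

(** The term with the bracket of the two fields drops out: in any direction, the
    covariant derivative at [x] of the field of [w] is a multiple of
    [dot w x = 0]. *)
Lemma curv_tproj r u v w x : 0 < r -> sphere r x -> dot w x = 0 ->
  curv r (fun y => tproj y u) (fun y => tproj y v) (fun y => tproj y w) x =
  (dot w (tproj x v) / r ^+ 2) *: tproj x u
  - (dot w (tproj x u) / r ^+ 2) *: tproj x v.
Proof.
move=> r0 xr wx; have x0 := sphere_neq0 r0 xr.
rewrite /curv !nabla_nabla_tproj// nabla_tproj// wx mul0r oppr0 scale0r subr0.
by rewrite !scaleNr opprK addrC.
Qed.

(** The trace of the curvature is exactly [n - 1] times [dot w w / r ^+ 2]. For
    an upper bound it is enough to drop the terms [- dot w e ^+ 2] and to bound
    the squared length of each frame vector by 1. *)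
Lemma ric_le r w x : 0 < r -> sphere r x -> dot w x = 0 ->
  ric r x w w <= n.+1%:R * (dot w w / r ^+ 2).
Proof.
move=> r0 xr wx; have x0 := sphere_neq0 r0 xr.
rewrite /ric mulr_natl -[X in _ *+ X]card_ord -sumr_const.
apply: ler_sum => i _; rewrite /tframe curv_tproj// (tproj_id wx).
rewrite dotBl !dotZl -/(tframe x i) (dotC w (tframe x i)).
have r2 : 0 < r ^+ 2 by rewrite exprn_gt0.
have ww : 0 <= dot w w / r ^+ 2 by rewrite divr_ge0 ?dot_ge0 ?ltW.
apply: (@le_trans _ _ (dot w w / r ^+ 2 * dot (tframe x i) (tframe x i))).
  rewrite gerDl oppr_le0 mulrAC -expr2 divr_ge0 ?sqr_ge0 ?ltW//.
by rewrite ler_piMr// dot_tframe_le1.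
Qed.

End TangentFields.

(** * The flat function [exp (- 1 / t)] *)

Section FlatFunction.
Variable R : realType.
Implicit Types (t : R) (m : nat).

(** The powers of [t^-1] are included because differentiation produces them: the
    family indexed by [m] is closed under derivatives up to linear
    combinations. *)
Definition expinv m t : R :=
  if 0 < t then t^-1 ^+ m * expR (- t^-1) else 0.

Lemma expinv_le0 m t : t <= 0 -> expinv m t = 0.
Proof. by rewrite /expinv leNgt => /negbTE ->. Qed.

Lemma expinv_gt0 m t : 0 < t -> expinv m t = t^-1 ^+ m * expR (- t^-1).
Proof. by rewrite /expinv => ->. Qed.

Lemma expinv_ge0 m t : 0 <= expinv m t.
Proof.
rewrite /expinv; case: ifPn => // t0.
by rewrite mulr_ge0 ?expR_ge0// exprn_ge0// invr_ge0 ltW.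
Qed.

(** With [s = t^-1] this is [s ^+ m / m`! <= expR s], one term of the exponential
    series. *)
Lemma expinv_le_fact m t : expinv m t <= m`!%:R.
Proof.
have [t0|t0] := leP t 0; first by rewrite expinv_le0.
rewrite expinv_gt0// expRN ler_pdivrMr ?expR_gt0//.
case: m => [|m].
  by rewrite expr0 fact0 mul1r -expR0 ler_expR invr_ge0 ltW.
have it0 : 0 <= t^-1 by rewrite invr_ge0 ltW.
have := expR_ge1Dxn m it0; have f0 : 0 < (m.+1)`!%:R :> R by rewrite ltr0n fact_gt0.
move=> /(le_trans _) H; rewrite mulrC -ler_pdivrMr//; apply: H.
by rewrite lerDr.
Qed.

(** Second-order vanishing at the origin, which makes the derivative there 0. *)
Lemma expinv_le_sqr m t : expinv m t <= (m.+2)`!%:R * t ^+ 2.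
Proof.
have [t0|t0] := leP t 0; first by rewrite expinv_le0// mulr_ge0 ?sqr_ge0.
rewrite -ler_pdivrMr ?exprn_gt0//; apply: le_trans (expinv_le_fact _ t).
by rewrite !expinv_gt0// -exprVn mulrAC -exprD addn2.
Qed.

Lemma is_derive_expinv m t :
  is_derive t 1 (expinv m) (expinv m.+2 t - m%:R * expinv m.+1 t).
Proof.
have [t0|t0|->] := ltgtP t 0.
- rewrite !(@expinv_le0 _ t) ?(ltW t0)// mulr0 subr0.
  apply: near_eq_is_derive (is_derive_cst 0 t 1).
  near=> s; rewrite expinv_le0// ltW//; near: s; exact: lt_nbhsl.
- rewrite !(@expinv_gt0 _ t)//.
  have it := is_derive_inv (f := id) (lt0r_neq0 t0) (is_derive_id t 1).
  rewrite mulN1r -exprVn in it.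
  have H := is_derive_mulf (is_derive_pow m it)
    (is_derive_chain (is_derive_mulc (-1) it) (is_derive_expR _)).
  apply: (near_eq_is_derive _ (is_derive_eq H _)).
    near=> s; rewrite expinv_gt0 /= ?mulN1r//; near: s; exact: lt_nbhsr.
  rewrite /= !mulN1r; case: m {H} => [|m] /=.
    by rewrite !mul0r add0r subr0 expr0; ring.
  by rewrite !exprS; ring.
- rewrite !(@expinv_le0 _ 0)// mulr0 subr0.
  have dq : h^-1 *: ((expinv m \o shift 0) (h *: 1) - expinv m 0) @[h --> 0^'] -->
      (0 : R).
    apply/cvgr0Pnorm_le => e e0; near=> h => /=.
    have h0 : h != 0 by near: h; exact: nbhs_dnbhs_neq.
    rewrite (@expinv_le0 _ 0)// subr0 addr0 /GRing.scale /= mulr1.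
    rewrite normrM normfV ler_pdivrMl ?normr_gt0// ger0_norm ?expinv_ge0//.
    apply: le_trans (expinv_le_sqr _ _) _.
    have f0 : 0 < (m.+2)`!%:R :> R by rewrite ltr0n fact_gt0.
    rewrite -real_normK ?num_real// expr2 mulrCA ler_wpM2l// mulrC -ler_pdivlMr//.
    by near: h; apply: dnbhs0_le; rewrite divr_gt0.
  split; first by apply/cvg_ex; exists 0; exact: dq.
  exact/cvg_lim/dq.
Unshelve. all: by end_near. Qed.
End FlatFunction.

(** * Iterated differentiability *)

Section IteratedDifferentiability.
Variables (R : realType) (V : normedModType R).
Implicit Types (D : set V) (f g : V -> R^o) (k : nat).

Lemma Ck_sub k D D' f : D' `<=` D -> Ck k D f -> Ck k D' f.
Proof.
elim: k f => [|k IH] f DD' /= [cf].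
  by split=> // x /DD'; exact: cf.
move=> [df Df]; split; first by move=> x /DD'; exact: cf.
by split=> [x v /DD'|v]; [exact: df|apply: IH => //; exact: Df].
Qed.

Lemma Ck_eq k D f g : open D -> {in D, f =1 g} -> Ck k D f -> Ck k D g.
Proof.
move=> oD; have nD (h h' : V -> R^o) x : {in D, h =1 h'} -> D x -> {near x, h =1 h'}.
  move=> hh' Dx; have : \forall y \near x, D y by exact: open_nbhs_nbhs.
  by apply: filterS => y Dy; apply: hh'; exact: mem_set.
have cD (h h' : V -> R^o) x : {in D, h =1 h'} -> D x ->
    {for x, continuous h} -> {for x, continuous h'}.
  rewrite /prop_for /continuous_at => hh' Dx; rewrite -hh' ?inE//.
  apply: cvg_trans.
  exact/near_eq_cvg/nD.
elim: k f g => [|k IH] f g fg [cf].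
  by split=> // x Dx; apply: cD fg Dx (cf x Dx).
move=> [df Df]; split; first by move=> x Dx; apply: cD fg Dx (cf x Dx).
split=> [x v Dx|v].
  by apply: near_eq_derivable (df x v Dx); exact: nD.
apply: IH (Df v) => x; rewrite inE => Dx; apply: near_eq_derive; exact: nD.
Qed.

Lemma Ck_cst k D (c : R) : Ck k D (cst c : V -> R^o).
Proof.
elim: k c => [|k IH] c; (split; first by move=> x _; exact: cst_continuous) => //.
split=> [x v _|v]; first exact: derivable_cst.
rewrite (_ : (fun x => _) = cst 0); first exact: IH.
by apply/funext => x; exact: derive_cst.
Qed.

Lemma CkW k D f : Ck k.+1 D f -> Ck k D f.
Proof.
elim: k f => [|k IH] f [cf [df Df]]; split=> //.
by split=> // v; apply: IH; exact: Df.
Qed.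

Lemma CkD k D f g : open D -> Ck k D f -> Ck k D g ->
  Ck k D (fun x => f x + g x).
Proof.
move=> oD; elim: k f g => [|k IH] f g [cf Hf] [cg Hg].
  by split=> // x Dx; apply: cvgD; [exact: cf|exact: cg].
case: Hf Hg => [df Df] [dg Dg].
split; first by move=> x Dx; apply: cvgD; [exact: cf|exact: cg].
split=> [x v Dx|v]; first by apply: derivableD; [exact: df|exact: dg].
apply: Ck_eq oD _ (IH _ _ (Df v) (Dg v)) => x; rewrite inE => Dx.
by rewrite -deriveD; [|exact: df|exact: dg].
Qed.

Lemma CkM k D f g : open D -> Ck k D f -> Ck k D g ->
  Ck k D (fun x => f x * g x).
Proof.
move=> oD; elim: k f g => [|k IH] f g Cf Cg.
  case: Cf Cg => [cf _] [cg _].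
  by split=> // x Dx; apply: cvgM; [exact: cf|exact: cg].
have Cf' := CkW Cf; have Cg' := CkW Cg.
case: Cf Cg => [cf [df Df]] [cg [dg Dg]].
split; first by move=> x Dx; apply: cvgM; [exact: cf|exact: cg].
split=> [x v Dx|v]; first by apply: derivableM; [exact: df|exact: dg].
apply: (Ck_eq oD _ (CkD oD (IH _ _ Cf' (Dg v)) (IH _ _ Cg' (Df v)))).
move=> x; rewrite inE => Dx.
by have /= -> := deriveM (df x v Dx) (dg x v Dx).
Qed.

Lemma Ck_sum (I : finType) k D (f : I -> V -> R^o) : open D ->
  (forall i, Ck k D (f i)) -> Ck k D (fun x => \sum_i f i x).
Proof.
move=> oD Cf; rewrite -(_ : \sum_i f i = fun x => \sum_i f i x); last first.
  by apply/funext => x; rewrite fct_sumE.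
elim/big_ind : _ => //; first exact: Ck_cst.
by move=> g h; exact: CkD.
Qed.

(** The induction on [k] must range over all [m], since a derivative raises
    [m]. *)
Lemma Ck_expinv k D f m : open D -> Ck k D f ->
  Ck k D (fun x => expinv m (f x)).
Proof.
move=> oD.
have cE j : continuous (@expinv R j).
  move=> t; apply: differentiable_continuous; apply/derivable1_diffP.
  by case: (is_derive_expinv j t).
elim: k m f => [|k IH] m f Cf.
  case: Cf => cf _; split=> // x Dx.
  by apply: (@continuous_comp _ _ _ f) => //; [exact: cf|exact: cE].
have Cf' := CkW Cf; case: Cf => [cf [df Df]].
have dE x v : D x -> is_derive x v (fun x => expinv m (f x) : R^o)
    ((expinv m.+2 (f x) - m%:R * expinv m.+1 (f x)) * 'D_v f x).
  move=> Dx.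
  exact: (is_derive_chain (derivableP (df x v Dx)) (is_derive_expinv m (f x))).
split; first by move=> x Dx; apply: (@continuous_comp _ _ _ f); [exact: cf|exact: cE].
split=> [x v Dx|v]; first by case: (dE x v Dx).
have H1 := CkM oD (Ck_cst k D (- m%:R)) (IH m.+1 f Cf').
apply: (Ck_eq oD _ (CkM oD (CkD oD (IH m.+2 f Cf') H1) (Df v))).
move=> x; rewrite inE => Dx; have [_ ->] := dE x v Dx.
by rewrite /= mulNr.
Qed.

End IteratedDifferentiability.

Lemma cvg_dot (R : realType) (n : nat) (T : Type) (F : set_system T)
    (FF : Filter F) (f g : T -> 'rV[R]_n) (u v : 'rV[R]_n) :
  f x @[x --> F] --> u -> g x @[x --> F] --> v ->
  dot (f x) (g x) @[x --> F] --> dot u v.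
Proof.
move=> fu gv; apply: (cvg_big (op := +%R)); first exact: add_continuous.
move=> i _; apply: cvgM.
  exact: (cvg_comp _ _ fu (@coord_continuous R 1 n 0 i u)).
exact: (cvg_comp _ _ gv (@coord_continuous R 1 n 0 i v)).
Qed.

Section SmoothRadial.
Variables (R : realType) (n : nat).
Implicit Types (p x : 'rV[R]_n.+1) (k : nat).

Lemma open_neq0 : open [set x : 'rV[R]_n.+1 | x != 0].
Proof. by rewrite openE => x /near_neq0. Qed.

Lemma Ck_dotr k (D : set 'rV[R]_n.+1) p :
  Ck k D (fun x => dot p x : R^o).
Proof.
have dp x v := is_derive_dotr p x v.
have cp x : {for x, continuous (fun y => dot p y : R^o)}.
  by apply: (@cvg_dot _ _ _ (nbhs x) _ (cst p) id); [exact: cvg_cst|exact: cvg_id].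
case: k => [|k]; split=> //; split=> [x v _|v]; first by case: (dp x v).
have -> : (fun x => 'D_v (fun y => dot p y : R^o) x) = cst (dot p v).
  by apply/funext => x; case: (dp x v).
exact: Ck_cst.
Qed.

(** The derivative along [v] is [- dot v x] times the cube of the function, so
    differentiability of order [k] implies that of order [k + 1]. *)
Lemma Ck_inv_enorm k :
  Ck k [set x | x != 0] (fun x : 'rV[R]_n.+1 => (enorm x)^-1 : R^o).
Proof.
have oD := open_neq0; have dw x v := @is_derive_inv_enorm R n x v.
have cw x : x != 0 ->
    {for x, continuous (fun x : 'rV[R]_n.+1 => (enorm x)^-1 : R^o)}.
  move=> x0; have e0 : enorm x != 0 by rewrite gt_eqF// enorm_gt0.
  have cd : dot y y @[y --> x] --> dot x x.
    by apply: (@cvg_dot _ _ _ (nbhs x) _ id id); exact: cvg_id.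
  have ce := cvg_comp _ _ cd (@sqrt_continuous R (dot x x)).
  exact: (@cvgV _ _ (nbhs x) _ _ _ e0 ce).
elim: k => [|k IH]; split=> //; split=> [x v x0|v]; first by case: (dw x v x0).
have H1 := CkM oD (Ck_cst k [set x | x != 0] (-1)) (Ck_dotr k _ v).
apply: (Ck_eq oD _ (CkM oD (CkM oD (CkM oD H1 IH) IH) IH)) => x.
rewrite inE => x0; have [_ ->] := dw x v x0.
by rewrite /= dotC exprS expr2 !invfM; ring.
Qed.

End SmoothRadial.

(** * Cutoff functions on the sphere *)

Section Cutoffs.
Variables (R : realType) (n : nat) (r b T : R).
Hypothesis r0 : 0 < r.
Implicit Types (p x v w : 'rV[R]_n.+1) (m : nat).

(** For [b > 0], positive exactly on the open ball of squared radius [T / b]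
    around [p]. *)
Definition gap p x : R := T - b * dot (x - p) (x - p).

(** The factor [expR 1] makes the function at least 1 where the gap is. *)
Definition cutoff p x : R := expR 1 * expinv 0 (gap p x).

Lemma cutoff_le p x : cutoff p x <= expR 1.
Proof. by rewrite ler_piMr ?expR_ge0// (le_trans (expinv_le_fact 0 _)). Qed.

Lemma cutoff_ge0 p x : 0 <= cutoff p x.
Proof. by rewrite mulr_ge0 ?expR_ge0 ?expinv_ge0. Qed.

Lemma cutoff_ge1 p x : 1 <= gap p x -> 1 <= cutoff p x.
Proof.
move=> q1; have q0 : 0 < gap p x by rewrite (lt_le_trans _ q1).
rewrite /cutoff expinv_gt0// expr0 mul1r -expRD -[leLHS]expR0 ler_expR subr_ge0.
by rewrite invf_le1.
Qed.

(** On the sphere [dot (x - p) (x - p)] is affine in [dot p x], so the ray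
    extension of the gap is affine in [dot p x / enorm x]. *)
Let zgap p x : R :=
  T - b * (r ^+ 2 + dot p p) + 2 * b * r * (dot p x * (enorm x)^-1).

Let gap_ray p x : x != 0 -> gap p (ray_proj r x) = zgap p x.
Proof.
move=> x0; have e0 : enorm x != 0 by rewrite gt_eqF// enorm_gt0.
have /sphere_dot := sphere_ray_proj r0 x0.
rewrite /gap /zgap => /(_ r0) xx.
rewrite !(dotBl, dotBr) xx /ray_proj !(dotZl, dotZr) (dotC x p); field.
exact: e0.
Qed.

Let gap_sphere p x : sphere r x -> zgap p x = gap p x.
Proof.
by move=> xr; rewrite -gap_ray ?ray_proj_id// (sphere_neq0 r0 xr).
Qed.

Let is_derive_zonal m p x v : sphere r x ->
  is_derive x v (fun y => expinv m (zgap p y))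
    ((expinv m.+2 (gap p x) - m%:R * expinv m.+1 (gap p x)) *
     (2 * b * dot (tproj x p) v)).
Proof.
move=> xr; have x0 := sphere_neq0 r0 xr.
have H := is_derive_mulc (2 * b * r)
  (is_derive_mulf (is_derive_dotr p x v) (is_derive_inv_enorm v x0)).
have H1 := is_deriveD (is_derive_cst (T - b * (r ^+ 2 + dot p p)) x v) H.
have H2 := is_derive_chain H1 (is_derive_expinv m _).
apply: is_derive_ext H2 => //; rewrite -gap_sphere//; congr (_ * _).
rewrite add0r [enorm x]xr /tproj dotBl dotZl (sphere_dot r0 xr); field.
by rewrite gt_eqF.
Qed.

(** Off the origin the ray extension is built from [dot p x], [enorm x] inverted
    and the flat function. *)
Lemma smooth_cutoff (I : finType) (Omega : set 'rV[R]_n.+1) (p : I -> 'rV[R]_n.+1)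
    (c : I -> R) :
  smooth r Omega (fun x => \sum_i c i * cutoff (p i) x).
Proof.
move=> k; apply: (@Ck_sub _ _ _ [set x | x != 0]); first by move=> x [].
have oD := @open_neq0 R n.
pose D := [set x : 'rV[R]_n.+1 | x != 0].
apply: (Ck_eq (f := fun x => \sum_i (c i * expR 1) * expinv 0 (zgap (p i) x))) => //.
  move=> x; rewrite inE => x0; apply: eq_bigr => i _.
  by rewrite /cutoff gap_ray// mulrA.
apply: Ck_sum => // i.
have := Ck_cst k D (c i * expR 1) => C1; apply: (CkM oD C1).
apply: Ck_expinv => //; apply: (CkD oD).
  exact: (Ck_cst k D (T - b * (r ^+ 2 + dot (p i) (p i)))).
apply: (CkM oD); first exact: (Ck_cst k D (2 * b * r)).
by apply: (CkM oD); [exact: Ck_dotr|exact: Ck_inv_enorm].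
Qed.

Section Combination.
Variables (j : nat) (p : 'I_j -> 'rV[R]_n.+1) (c : 'I_j -> R).

Let u x := \sum_i c i * cutoff (p i) x.

(** Each cutoff depends on [dot p x] only, and the tangential gradient of
    [dot p x] is the projection of [p]. *)
Lemma grad_cutoff x : sphere r x ->
  grad r u x = \sum_i
    (c i * (2 * b * expR 1 * expinv 2 (gap (p i) x))) *: tproj x (p i).
Proof.
move=> xr; have x0 := sphere_neq0 r0 xr.
set g := \sum_i _; suff D (v : 'rV[R]_n.+1) : 'D_v (ray r u : _ -> R^o) x = dot g v.
  have E : \row_i 'D_(delta_mx 0 i) (ray r u : _ -> R^o) x = g.
    by apply/rowP => i; rewrite mxE D dot_deltar.
  rewrite /grad E tproj_id//.
  rewrite dot_suml big1// => i _.
  by rewrite dotZl dot_tproj_pos// mulr0.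
have H i := is_derive_mulc (c i * expR 1) (is_derive_zonal 0 (p i) v xr).
have : is_derive x v (ray r u : _ -> R^o) (dot g v); last by case.
apply: (is_derive_near_neq0 x0 _ (is_derive_eq (is_derive_sum H) _)).
  move=> y y0; rewrite fct_sumE; apply: eq_bigr => i _.
  by rewrite /cutoff gap_ray// mulrA.
rewrite dot_suml; apply: eq_bigr => i _; rewrite dotZl mul0r subr0; ring.
Qed.

(** Product rule: the first term differentiates the scalar factor of the
    gradient, the second one the field [tproj x (p i)]. *)
Lemma hess_cutoff x v w : sphere r x ->
  hess r u x v w = \sum_i c i * (2 * b * expR 1 *
    ((expinv 4 (gap (p i) x) - 2 * expinv 3 (gap (p i) x)) * (2 * b) *
       dot (tproj x (p i)) v * dot (tproj x (p i)) w
     - expinv 2 (gap (p i) x) * (dot (p i) x / r ^+ 2) * dot (tproj x v) w)).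
Proof.
move=> xr; have x0 := sphere_neq0 r0 xr.
have T1 i := is_derive_tproj v (p i) x0.
pose k i := sval (cid (T1 i)).
have T2 i : is_derive x v (fun y => tproj y (p i))
    (k i *: x - (dot (p i) x / dot x x) *: v) := svalP (cid (T1 i)).
have H i := is_derive_scale
  (is_derive_mulc (c i * (2 * b * expR 1)) (is_derive_zonal 2 (p i) v xr)) (T2 i).
rewrite /hess (nabla_is_derive x0 _ (is_derive_sum H)); last first.
  move=> y y0; rewrite fct_sumE grad_cutoff; last exact: sphere_ray_proj.
  apply: eq_bigr => i _; rewrite gap_ray// tprojZl ?mulrA//.
  by rewrite mulf_neq0 ?invr_neq0 ?gt_eqF// enorm_gt0.
rewrite tproj_sum dot_suml; apply: eq_bigr => i _.
rewrite tprojD !tprojZ tprojK// tprojD -[- (_ *: v)]scaleNr !tprojZ tproj_pos//.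
rewrite scaler0 add0r dotDl !dotZl gap_sphere// (sphere_dot r0 xr); ring.
Qed.

End Combination.
End Cutoffs.

(** * Pointwise bounds for cutoffs with disjoint supports *)

Section DisjointSums.
Variables (I : finType) (act : pred I).
Hypothesis act_inj : forall i k, act i -> act k -> i = k.

(** When at most one index is active, the sum is 0 or a single active term. *)
Lemma sum_disjoint_ind (V : nmodType) (P : V -> Prop) (f : I -> V) :
  (forall i, ~~ act i -> f i = 0) -> P 0 -> (forall i, act i -> P (f i)) ->
  P (\sum_i f i).
Proof.
move=> f0 P0 Pf; case: (pickP act) => [i ai|na]; last first.
  by rewrite big1// => i _; rewrite f0// na.
rewrite (bigD1 i)//= big1 ?addr0; first exact: Pf.
move=> k ki; apply: f0; apply: contra ki => ak; exact/eqP/act_inj.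
Qed.

End DisjointSums.

Section PointwiseBounds.
Variables (R : realType) (n : nat) (r b T : R).
Hypotheses (r0 : 0 < r) (T1 : 1 <= T) (br1 : 1 <= b * r ^+ 2).
Implicit Types (p x v w : 'rV[R]_n.+1).

Let b0 : 0 < b.
Proof. by rewrite -(pmulr_lgt0 _ (exprn_gt0 2 r0)) (lt_le_trans ltr01). Qed.

Lemma abs_dot_le1 v w : dot v v <= 1 -> dot w w <= 1 -> `|dot v w| <= 1.
Proof.
move=> v1 w1; rewrite -(ler_pXn2r (n := 2)) ?nnegrE// expr1n real_normK ?num_real//.
apply: (le_trans (dot_cauchy_schwarz v w)).
by rewrite -[leRHS]mulr1 ler_pM ?dot_ge0.
Qed.

Lemma abs_combination_le (s t : R) : 0 <= s -> 0 <= t -> s <= 24 -> t <= 6 ->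
  `|(s - 2 * t) * 2| <= 72.
Proof. by move=> ? ? ? ?; rewrite ler_norml; apply/andP; split; lra. Qed.

(** [x] itself projects to 0, so [p] may be replaced by [p - x], which is short on
    the support. *)
Lemma tproj_center_le p x : x != 0 -> 0 < gap b T p x ->
  b * dot (tproj x p) (tproj x p) <= T.
Proof.
move=> x0; rewrite subr_gt0 => /ltW; apply: le_trans.
have -> : tproj x p = tproj x (- (x - p)).
  by rewrite opprB tprojD -[in RHS]scaleN1r tprojZ tproj_pos// scaler0 addr0.
rewrite ler_pM2l//; apply: (le_trans (dot_tproj_le _ x0)).
by rewrite dotNl dotNr opprK.
Qed.

(** [p] is within a bounded multiple of [r] of [x] because [1 / b <= r ^+ 2]. *)
Lemma dot_center_le p x : sphere r x -> 0 < gap b T p x ->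
  `|dot p x / r ^+ 2| <= 1 + T.
Proof.
move=> xr; rewrite subr_gt0 => /ltW bT; have xx := sphere_dot r0 xr.
have r2 : 0 < r ^+ 2 by rewrite exprn_gt0.
have cs := dot_cauchy_schwarz (x - p) x; rewrite xx in cs.
have px : dot p x = r ^+ 2 - dot (x - p) x by rewrite dotBl xx; ring.
have D0 := dot_ge0 (x - p); set D := dot (x - p) (x - p) in bT cs D0 *.
have DT : D <= T * r ^+ 2.
  apply: (@le_trans _ _ (b * r ^+ 2 * D)); first by rewrite ler_peMl.
  by rewrite mulrAC ler_wpM2r// (ltW r2).
have T0 : 0 <= T by apply: le_trans T1.
have : `|dot (x - p) x| <= T * r ^+ 2.
  have Tr : 0 <= T * r ^+ 2 by rewrite mulr_ge0 // (ltW r2).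
  rewrite -(ler_pXn2r (n := 2)) ?nnegrE// real_normK ?num_real//.
  apply: (le_trans cs); rewrite expr2.
  apply: ler_pM => //; first exact: ltW.
  by rewrite ler_peMl ?(ltW r2).
rewrite normrM normfV (gtr0_norm r2) ler_pdivrMr// px => H.
apply: (le_trans (ler_normB _ _)); rewrite (gtr0_norm r2); lra.
Qed.

(** The two projections of [p] are of size [(T / b)^(1/2)], which turns the
    factor [b ^+ 2] of the first term into [b]. By [expinv_le_fact] the scalars in
    the two terms are at most [4! + 2 * 3! = 36] and [2! = 2], whence the bound
    [2 b (expR 1) (72 T + 2 (1 + T))]. *)
Lemma hess_term_le p x v w : sphere r x -> 0 < gap b T p x ->
  dot v v <= 1 -> dot w w <= 1 ->
  `|2 * b * expR 1 *
    ((expinv 4 (gap b T p x) - 2 * expinv 3 (gap b T p x)) * (2 * b) *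
       dot (tproj x p) v * dot (tproj x p) w
     - expinv 2 (gap b T p x) * (dot p x / r ^+ 2) * dot (tproj x v) w)|
  <= 152 * expR 1 * T * b.
Proof.
move=> xr gx v1 w1; have x0 := sphere_neq0 r0 xr.
have pT := tproj_center_le x0 gx.
have s1 := dot_center_le xr gx; set s := _ / _ in s1 *.
have t1 : `|dot (tproj x v) w| <= 1.
  by apply: abs_dot_le1 => //; apply: le_trans v1; exact: dot_tproj_le.
set t := dot (tproj x v) w in t1 *.
have cs z : dot z z <= 1 -> b * dot (tproj x p) z ^+ 2 <= T.
  move=> z1; apply: le_trans pT; rewrite ler_pM2l//.
  apply: (le_trans (dot_cauchy_schwarz _ _)); rewrite ler_piMr ?dot_ge0//.
have {cs} [a1 a2] := (cs v v1, cs w w1).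
set a := dot _ v in a1 *; set a' := dot _ w in a2 *.
have aa : `|b * a * a'| <= T.
  have M1 : 0 <= b * (a - a') ^+ 2 by rewrite mulr_ge0 ?sqr_ge0 ?(ltW b0).
  have M2 : 0 <= b * (a + a') ^+ 2 by rewrite mulr_ge0 ?sqr_ge0 ?(ltW b0).
  by rewrite ler_norml; apply/andP; split; lra.
have E4 : expinv 4 (gap b T p x) <= 24 := expinv_le_fact 4 _.
have E4p := expinv_ge0 4 (gap b T p x).
have E3 : expinv 3 (gap b T p x) <= 6 := expinv_le_fact 3 _.
have E3p := expinv_ge0 3 (gap b T p x).
have E2 : expinv 2 (gap b T p x) <= 2 := expinv_le_fact 2 _.
have E2p := expinv_ge0 2 (gap b T p x).
move: E4 E3 E2 E4p E3p E2p.
set e4 := expinv 4 _; set e3 := expinv 3 _; set e2 := expinv 2 _.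
move=> e4l e3l e2l e4p e3p e2p.
have e0 := expR_gt0 (1 : R).
have A1 : `|(e4 - 2 * e3) * 2 * (b * a * a')| <= 72 * T.
  by rewrite normrM ler_pM// abs_combination_le.
have A2 : `|e2 * s * t| <= 2 * (1 + T).
  rewrite 2!normrM -[leRHS]mulr1 ler_pM// ler_pM//.
  by rewrite ger0_norm.
have -> : 152 * expR 1 * T * b = 2 * b * expR 1 * (76 * T) by ring.
rewrite normrM (gtr0_norm (x := 2 * b * expR 1)) ?mulr_gt0// ler_pM2l ?mulr_gt0//.
have -> : (e4 - 2 * e3) * (2 * b) * a * a' = (e4 - 2 * e3) * 2 * (b * a * a').
  by ring.
apply: (le_trans (ler_normB _ _)); apply: (le_trans (lerD A1 A2)).
by have T1' := T1; lra.
Qed.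

Lemma grad_term_le p x : x != 0 -> 0 < gap b T p x ->
  (2 * b * expR 1 * expinv 2 (gap b T p x)) ^+ 2 *
    dot (tproj x p) (tproj x p) <= 16 * expR 1 ^+ 2 * T * b.
Proof.
move=> x0 gx; have := tproj_center_le x0 gx; set d := dot _ _ => bd.
have E2 : expinv 2 (gap b T p x) <= 2 := expinv_le_fact 2 _.
have E2p := expinv_ge0 2 (gap b T p x).
move: E2 E2p; set e2 := expinv 2 _ => e2l e2p.
have -> : (2 * b * expR 1 * e2) ^+ 2 * d = 4 * expR 1 ^+ 2 * b * (e2 ^+ 2 * (b * d)).
  by ring.
have -> : 16 * expR 1 ^+ 2 * T * b = 4 * expR 1 ^+ 2 * b * (4 * T) by ring.
rewrite ler_pM2l ?mulr_gt0 ?exprn_gt0 ?expR_gt0// ler_pM ?sqr_ge0//.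
  by rewrite mulr_ge0 ?dot_ge0// ltW.
rewrite expr2; nra.
Qed.

(** Two contributions: [n.+1 ^+ 2] Hessian entries, and the Ricci form as bounded
    by the gradient. *)
Definition energy_const : R :=
  n.+1%:R ^+ 2 * (152 * expR 1 * T) ^+ 2 + n.+1%:R * (16 * expR 1 ^+ 2 * T).

(** Depends on the scale [b]: it only serves to show that the [H^2] norms are
    finite. *)
Definition norm_const : R :=
  n.+1%:R ^+ 2 * (152 * expR 1 * T * b) ^+ 2 + 16 * expR 1 ^+ 2 * T * b
  + expR 1 ^+ 2.

Section Combination.
Variables (j : nat) (p : 'I_j -> 'rV[R]_n.+1) (c : 'I_j -> R) (x : 'rV[R]_n.+1).
Hypothesis xr : sphere r x.
Hypothesis act_inj : forall i k, 0 < gap b T (p i) x -> 0 < gap b T (p k) x -> i = k.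

Let u y := \sum_i c i * cutoff b T (p i) y.
Let S := \sum_i c i ^+ 2 * (0 < gap b T (p i) x)%R%:R.

Let S_ge0 : 0 <= S.
Proof. by apply: sumr_ge0 => i _; rewrite mulr_ge0 ?sqr_ge0. Qed.

Let S_act i : 0 < gap b T (p i) x -> S = c i ^+ 2.
Proof.
move=> gi; rewrite /S (bigD1 i)//= gi mulr1 big1 ?addr0// => k ki.
case: (ltP 0 (gap b T (p k) x)) => [gk|_]; last by rewrite mulr0.
by rewrite (act_inj gi gk) eqxx in ki.
Qed.

Let hess_le v w : dot v v <= 1 -> dot w w <= 1 ->
  hess r u x v w ^+ 2 <= (152 * expR 1 * T * b) ^+ 2 * S.
Proof.
move=> v1 w1; rewrite hess_cutoff//.
apply: (sum_disjoint_ind (P := fun s : R => s ^+ 2 <= _) act_inj).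
- move=> i; rewrite -leNgt => gi.
  by rewrite !(@expinv_le0 _ _ (gap b T _ _))//; ring.
- by rewrite expr0n /= mulr_ge0 ?sqr_ge0.
move=> i gi; rewrite (S_act gi) exprMn mulrC ler_wpM2r ?sqr_ge0//.
rewrite -real_normK ?num_real// ler_sqr ?nnegrE//; last first.
  by rewrite !mulr_ge0 ?expR_ge0 ?(le_trans _ T1) ?(ltW b0).
exact: hess_term_le.
Qed.

Lemma hess_normsq_cutoff_le :
  hess_normsq r u x <= n.+1%:R ^+ 2 * (152 * expR 1 * T * b) ^+ 2 * S.
Proof.
have x0 := sphere_neq0 r0 xr.
apply: (@le_trans _ _ (\sum_(i < n.+1) \sum_(k < n.+1)
    (152 * expR 1 * T * b) ^+ 2 * S)).
  by do 2![apply: ler_sum => ? _]; apply: hess_le; exact: dot_tframe_le1.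
by rewrite !sumr_const !card_ord -mulrnA -[leLHS]mulr_natl natrM mulrA expr2.
Qed.

Lemma grad_cutoff_le : dot (grad r u x) (grad r u x) <=
  16 * expR 1 ^+ 2 * T * b * S.
Proof.
have x0 := sphere_neq0 r0 xr.
rewrite grad_cutoff//.
apply: (sum_disjoint_ind (P := fun g => dot g g <= _) act_inj).
- move=> i; rewrite -leNgt => gi.
  by rewrite (@expinv_le0 _ _ (gap b T _ _))// !mulr0 scale0r.
- by rewrite dot0l !mulr_ge0 ?sqr_ge0 ?(le_trans _ T1) ?(ltW b0).
move=> i gi; rewrite (S_act gi) dotZl dotZr.
set d := dot _ _; set e := 2 * b * _ * _.
have -> : c i * e * (c i * e * d) = e ^+ 2 * d * c i ^+ 2 by ring.
by rewrite ler_wpM2r ?sqr_ge0// grad_term_le.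
Qed.

(** The Ricci form is at most [n.+1 / r ^+ 2] times the squared gradient, and
    [1 / r ^+ 2 <= b], so it is of the same order [b ^+ 2] as the Hessian. *)
Lemma energy_density_le :
  hess_normsq r u x + ric r x (grad r u x) (grad r u x) <=
  energy_const * b ^+ 2 * S.
Proof.
have x0 := sphere_neq0 r0 xr.
have gx : dot (grad r u x) x = 0 by rewrite dot_tproj_pos.
have R1 := ric_le r0 xr gx; have G := grad_cutoff_le; have H := hess_normsq_cutoff_le.
set D := dot (grad r u x) _ in R1 G.
have R2 : n.+1%:R * (D / r ^+ 2) <= n.+1%:R * (b * D).
  rewrite ler_wpM2l// ler_pdivrMr ?exprn_gt0// mulrAC.
  by rewrite ler_peMl ?dot_ge0// .
have R3 : n.+1%:R * (b * D) <= n.+1%:R * (b * (16 * expR 1 ^+ 2 * T * b * S)).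
  by rewrite ler_wpM2l// ler_pM2l.
apply: le_trans (lerD H (le_trans R1 (le_trans R2 R3))) _.
by rewrite /energy_const; apply: eq_ler; ring.
Qed.

Let sqr_cutoff : u x ^+ 2 = \sum_i c i ^+ 2 * cutoff b T (p i) x ^+ 2.
Proof.
have [i gi|ng] := pickP (fun i => 0 < gap b T (p i) x); last first.
  have bz i : cutoff b T (p i) x = 0.
    by rewrite /cutoff expinv_le0 ?mulr0// leNgt ng.
  by rewrite /u !big1 ?expr0n// => i _; rewrite bz ?mulr0// expr0n mulr0.
have bz k : k != i -> cutoff b T (p k) x = 0.
  move=> ki; rewrite /cutoff expinv_le0 ?mulr0// leNgt.
  by apply: contra ki => gk; apply/eqP/act_inj.
have -> : u x = c i * cutoff b T (p i) x.
  by rewrite /u (bigD1 i)//= big1 ?addr0// => k ki; rewrite bz// mulr0.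
rewrite exprMn (bigD1 i)//= big1 ?addr0// => k ki.
by rewrite bz// expr0n mulr0.
Qed.

Lemma sqr_cutoff_le : u x ^+ 2 <= expR 1 ^+ 2 * S.
Proof.
rewrite sqr_cutoff mulr_sumr; apply: ler_sum => i _.
rewrite [leRHS]mulrCA ler_wpM2l ?sqr_ge0//.
case: (ltP 0 (gap b T (p i) x)) => [_|gi]; last first.
  by rewrite /cutoff expinv_le0// mulr0 expr0n mulr0.
by rewrite mulr1 ler_sqr ?nnegrE ?cutoff_le ?cutoff_ge0 ?expR_ge0.
Qed.

Lemma sqr_cutoff_ge : \sum_i c i ^+ 2 * (1 <= gap b T (p i) x)%R%:R <= u x ^+ 2.
Proof.
rewrite sqr_cutoff; apply: ler_sum => i _; rewrite ler_wpM2l ?sqr_ge0//.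
case: (leP 1 (gap b T (p i) x)) => [gi|_]; last exact: sqr_ge0.
by rewrite exprn_ege1 ?cutoff_ge1.
Qed.

Lemma norm_density_le :
  hess_normsq r u x + dot (grad r u x) (grad r u x) + u x ^+ 2 <= norm_const * S.
Proof.
rewrite /norm_const 2![(_ + _) * S]mulrDl.
exact: lerD (lerD hess_normsq_cutoff_le grad_cutoff_le) sqr_cutoff_le.
Qed.

End Combination.
End PointwiseBounds.

(** * Integrals and product boxes *)

Section MonotoneIntegral.
Local Open Scope ereal_scope.
Context (d : measure_display) (X : measurableType d) (R : realType).
Variable mu : {measure set X -> \bar R}.

(** The integral of a non-negative function is a supremum over the simple
    functions below it, hence monotone without any measurability; the negative
    part of [f] only lowers the left-hand side. *)
Lemma le_integral_ge0r (D : set X) (f g : X -> \bar R) :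
  (forall x, D x -> f x <= g x) -> (forall x, D x -> 0 <= g x) ->
  \int[mu]_(x in D) f x <= \int[mu]_(x in D) g x.
Proof.
move=> fg g0; rewrite integralE.
have fp x : D x -> 0 <= f^\+ x by move=> _; exact: funepos_ge0.
have fn : 0 <= \int[mu]_(x in D) f^\- x.
  by apply: integral_ge0 => x _; exact: funeneg_ge0.
apply: (@le_trans _ _ (\int[mu]_(x in D) f^\+ x)).
  by rewrite -[leRHS]sube0; apply: leeB.
rewrite !ge0_integralE//; apply: le_ereal_sup => _ [h hf <-]; exists h => //.
move=> x; apply: (le_trans (hf x)); rewrite /patch; case: ifPn => // /[!inE] Dx.
by rewrite funeposE ge_max fg ?g0.
Qed.

End MonotoneIntegral.

Section ProductBoxes.
Context (d : measure_display) (X : measurableType d) (R : realType).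
Variable m : {sigma_finite_measure set X -> \bar R}.

Lemma measurable_box n (A : 'I_n -> set X) : (forall i, measurable (A i)) ->
  measurable [set t : n.-tuple X | forall i, A i (tnth t i)].
Proof.
move=> mA; rewrite (_ : [set _ | _] =
    \bigcap_(i in [set: 'I_n]) ((fun t => tnth t i) @^-1` A i)); last first.
  by apply/seteqP; split=> [t /= At i _|t /= At i]; exact: At.
apply: fin_bigcap_measurable => // i _.
by have := @measurable_tnth _ X n i measurableT _ (mA i); rewrite setTI.
Qed.

Lemma measure_power_box n (A : 'I_n -> set X) : (forall i, measurable (A i)) ->
  measure_power m n [set t | forall i, A i (tnth t i)] =
  (\prod_(i < n) m (A i))%E.
Proof.
elim: n A => [|n IH] A mA.
  rewrite big_ord0 /= diracE mem_set// => -[]//.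
rewrite big_ord_recl -IH//= /measure_cons /pushforward.
rewrite -product_measure1E//; last first.
  by apply: (@measurable_box _ (fun i => A (lift ord0 i))).
congr (_ _); apply/seteqP; split=> -[x t] /=.
  move=> At; split; first by have := At ord0; rewrite (tnth_nth x).
  by move=> i; have := At (lift ord0 i); rewrite !(tnth_nth x).
move=> [/= Ax At] i; case: (unliftP ord0 i) => [k ->|->].
  by have := At k; rewrite !(tnth_nth x).
by rewrite (tnth_nth x).
Qed.

End ProductBoxes.

(** * The stereographic charts *)

Section Stereographic.
Variables (R : realType) (n : nat) (r : R).
Implicit Types (y v : 'rV[R]_n) (s : bool).

(** The conformal factor of the inverse stereographic projection on the unit
    sphere. *)
Definition conf y : R := 2 / (1 + dot y y).

Lemma conf_gt0 y : 0 < conf y.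
Proof. by rewrite divr_gt0// ltr_pwDl ?dot_ge0. Qed.

Let confD y : 1 + dot y y != 0.
Proof. by rewrite gt_eqF// ltr_pwDl ?dot_ge0. Qed.

Lemma conf_le2 y : conf y <= 2.
Proof. by rewrite ler_pdivrMr ?ltr_pwDl ?dot_ge0// ler_peMr// lerDl dot_ge0. Qed.

Lemma conf_ge1 y : dot y y <= 1 -> 1 <= conf y.
Proof. by move=> y1; rewrite ler_pdivlMr ?ltr_pwDl ?dot_ge0// mul1r lerD2l. Qed.

Lemma stereo0 s y : stereo r s y 0 ord0 = (-1) ^+ s * (r * (conf y - 1)).
Proof.
rewrite /stereo mxE (_ : ord0 = lshift n (ord0 : 'I_1)); last exact: val_inj.
rewrite row_mxEl mxE eqxx mulr1n mulrCA; congr (_ * _).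
by rewrite /conf; field.
Qed.

Lemma stereoS s y b : stereo r s y 0 (lift ord0 b) = r * conf y * y 0 b.
Proof.
rewrite /stereo mxE (_ : lift ord0 b = rshift 1 b); last exact: val_inj.
by rewrite row_mxEr mxE /conf; field.
Qed.

Lemma is_derive_conf y v : is_derive y v conf (- conf y ^+ 2 * dot y v).
Proof.
have H := is_deriveD (is_derive_cst (1 : R) y v) (is_derive_dotxx y v).
have H1 := is_derive_mulc 2 (@is_derive_inv _ _ (fun z => 1 + dot z z) y v _ (confD y) H).
apply: is_derive_ext H1 => //.
by rewrite /= add0r /conf; field.
Qed.

Let dstereo s y v : 'rV[R]_n.+1 :=
  \row_a if unlift ord0 a is Some b
         then r * (- conf y ^+ 2 * dot y v * y 0 b + conf y * v 0 b)
         else (-1) ^+ s * (r * (- conf y ^+ 2 * dot y v)).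

Lemma is_derive_stereo s y v : is_derive y v (stereo r s) (dstereo s y v).
Proof.
apply: is_derive_row => a; rewrite mxE; case: unliftP => [b ->|->].
  apply: is_derive_ext (is_derive_mulc r
    (is_derive_mulf (is_derive_conf y v) (is_derive_entry y v b))) => // z.
  by rewrite stereoS mulrA.
have H := is_deriveB (is_derive_conf y v) (is_derive_cst (1 : R) y v).
apply: is_derive_ext (is_derive_mulc ((-1) ^+ s * r) H).
  by move=> z; rewrite stereo0 mulrA.
by rewrite subr0 -[LHS]mulrA.
Qed.

Lemma differentiable_conf y : differentiable conf y.
Proof.
have H : differentiable (fun z => 1 + dot z z : R) y.
  apply: differentiableD; first exact: differentiable_cst.
  rewrite (_ : (fun z => _) = \sum_(i < n) (fun z : 'rV[R]_n => z 0 i * z 0 i)).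
    by apply: differentiable_sum => i; apply: differentiableM;
      exact: differentiable_coord.
  by apply/funext => z; rewrite fct_sumE.
apply: differentiableM; first exact: differentiable_cst.
exact: differentiableV.
Qed.

Lemma differentiable_stereo s y : differentiable (stereo r s) y.
Proof.
rewrite (_ : stereo r s = \sum_(a < n.+1)
    (fun z : 'rV[R]_n => stereo r s z 0 a *: (delta_mx 0 a : 'rV[R]_n.+1))).
  apply: differentiable_sum => a; apply: differentiableZl.
  case: (unliftP ord0 a) => [b ->|->].
    under eq_fun do rewrite stereoS.
    apply: differentiableM; last exact: differentiable_coord.
    apply: differentiableM; first exact: differentiable_cst.
    exact: differentiable_conf.
  under eq_fun do rewrite stereo0.
  apply: differentiableM; first exact: differentiable_cst.
  apply: differentiableM; first exact: differentiable_cst.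
  apply: differentiableB; [exact: differentiable_conf|exact: differentiable_cst].
apply/funext => z; rewrite fct_sumE [LHS]row_sum_delta.
by apply: eq_bigr => a _.
Qed.

(** The inverse stereographic projection is conformal with factor [r * conf y]:
    the Gram matrix of its Jacobian is scalar. *)
Lemma vol_density_conf s y : 0 < r -> vol_density r s y = (r * conf y) ^+ n.
Proof.
move=> r0; rewrite /vol_density; set J := jacobian _ _.
have JE i a : J i a = dstereo s y (delta_mx 0 i) 0 a.
  rewrite mxE -deriveE; last exact: differentiable_stereo.
  by case: (is_derive_stereo s y (delta_mx 0 i)) => _ ->.
clearbody J; have -> : J *m J^T = ((r * conf y) ^+ 2)%:M.
  apply/matrixP => i k; rewrite !mxE big_ord_recl.
  rewrite mxE !JE 2![dstereo _ _ _ _ ord0]mxE unlift_none !dot_deltar.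
  pose A := r ^+ 2 * conf y ^+ 4 * y 0 i * y 0 k.
  pose B := r ^+ 2 * conf y ^+ 2.
  pose C := r ^+ 2 * conf y ^+ 3.
  rewrite (eq_bigr (fun b => A * (y 0 b * y 0 b)
     - C * y 0 i * (y 0 b * (delta_mx 0 k : 'rV[R]_n) 0 b)
     - C * y 0 k * (y 0 b * (delta_mx 0 i : 'rV[R]_n) 0 b)
     + B * ((delta_mx 0 i : 'rV[R]_n) 0 b * (delta_mx 0 k : 'rV[R]_n) 0 b)));
    last first.
    move=> b _; rewrite mxE !JE 2![dstereo _ _ _ _ (lift _ _)]mxE liftK !dot_deltar.
    by rewrite /A /B /C; ring.
  rewrite big_split !sumrB -!mulr_sumr -!/(dot _ _) !dot_deltar mxE eqxx /=.
  rewrite /A /B /C eq_sym -mulr_natr.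
  have -> : dot y y = 2 / conf y - 1.
    by rewrite /conf; field; rewrite confD.
  have := conf_gt0 y; set l := conf y => l0.
  have -> : ((-1) ^+ s * (r * (- l ^+ 2 * y 0 i))) *
     ((-1) ^+ s * (r * (- l ^+ 2 * y 0 k))) = r ^+ 2 * l ^+ 4 * y 0 i * y 0 k.
    by case: (s); rewrite ?expr0 ?expr1; ring.
  by field; rewrite gt_eqF.
rewrite det_scalar -exprM mulnC exprM sqrtr_sqr ger0_norm// exprn_ge0//.
by rewrite mulr_ge0 ?ltW ?conf_gt0.
Qed.

End Stereographic.

Section ChartEstimate.
Variables (R : realType) (n : nat) (r : R).
Hypothesis r0 : 0 < r.
Implicit Types (y : 'rV[R]_n) (s : bool).

(** A coordinate of [y] is a coordinate of [stereo r s y] divided by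
    [r * conf y], and the latter is [r] plus, up to sign, the first coordinate of
    [stereo r s y]; on the unit ball [conf y] is at least 1. *)
Lemma stereo_inverse_lipschitz s y z (e : R) : dot y y <= 1 -> dot z z <= 1 ->
  (forall a, `|stereo r s y 0 a - stereo r s z 0 a| <= e) ->
  forall b, `|y 0 b - z 0 b| <= 2 * e / r.
Proof.
move=> y1 z1 He b.
have E0 : `|r * conf y - r * conf z| <= e.
  have := He ord0; rewrite !stereo0 -mulrBr normrM normrX normrN1 expr1n mul1r.
  by rewrite -mulrBr opprB addrA subrK mulrBr.
have := He (lift ord0 b); rewrite !stereoS => Eb.
have zb : `|z 0 b| <= 1.
  rewrite -(ler_pXn2r (n := 2)) ?nnegrE// expr1n real_normK ?num_real//.
  apply: le_trans z1; rewrite /dot (bigD1 b)//= -expr2 lerDl.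
  by apply: sumr_ge0 => i _; rewrite -expr2 sqr_ge0.
rewrite ler_pdivlMr//.
have cy := conf_ge1 y1.
have H : `|y 0 b - z 0 b| * (r * conf y) <= 2 * e.
  have rc : 0 <= r * conf y by rewrite mulr_ge0 ?(ltW r0) ?(le_trans ler01).
  rewrite -[X in _ * X]ger0_norm// -normrM.
  have -> : (y 0 b - z 0 b) * (r * conf y) =
    (r * conf y * y 0 b - r * conf z * z 0 b) - (r * conf y - r * conf z) * z 0 b.
    by ring.
  apply: (le_trans (ler_normB _ _)); rewrite mulr_natl mulr2n lerD//.
  by rewrite normrM -[leRHS]mulr1 ler_pM.
apply: le_trans H; rewrite ler_wpM2l// ler_peMr// ltW//.
Qed.

Lemma stereo_sphere s y : sphere r (stereo r s y).
Proof.
rewrite /sphere /= /enorm (_ : dot _ _ = r ^+ 2) ?sqrtr_sqr ?gtr0_norm//.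
rewrite /dot big_ord_recl !stereo0.
rewrite (eq_bigr (fun b => (r * conf y) ^+ 2 * (y 0 b * y 0 b))); last first.
  by move=> b _; rewrite !stereoS; ring.
rewrite -mulr_sumr -/(dot y y).
have -> : (-1) ^+ s * (r * (conf y - 1)) * ((-1) ^+ s * (r * (conf y - 1))) =
    (r * (conf y - 1)) ^+ 2.
  by case: s; rewrite ?expr0 ?expr1; ring.
rewrite /conf; field.
by rewrite gt_eqF// ltr_pwDl ?dot_ge0.
Qed.

End ChartEstimate.

Section Measurability.
Context (d : measure_display) (X : measurableType d) (R : realType).

(** An open set is the countable union of the rational boxes it contains. *)
Lemma measurable_preimage_open n (F : X -> 'rV[R]_n) (O : set 'rV[R]_n) :
  (forall i, measurable_fun setT (fun x => F x 0 i : R)) -> open O ->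
  measurable (F @^-1` O).
Proof.
move=> mF oO.
pose B (q : 'rV[rat]_n * nat) := [set x : 'rV[R]_n |
  forall i, `|x 0 i - ratr (q.1 0 i)| < q.2.+1%:R^-1].
have -> : F @^-1` O = \bigcup_(q in [set: 'rV[rat]_n * nat])
    (if pselect (B q `<=` O) then F @^-1` B q else set0).
  apply/seteqP; split => [x Ox|x [q _]] /=; last first.
    by case: pselect => // qO; exact: qO.
  have /nbhs_ballP[e /= e0 xO] : nbhs (F x) O by exact: open_nbhs_nbhs.
  have [k ke] : exists k : nat, k.+1%:R^-1 < e / 2.
    exists (Num.truncn (e / 2)^-1).
    have h0 : 0 < e / 2 by rewrite divr_gt0.
    by rewrite -[ltRHS]invrK ltf_pV2 ?posrE ?invr_gt0// truncnS_gt.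
  have k0 : 0 < k.+1%:R^-1 :> R by rewrite invr_gt0.
  have dr i : exists q : rat, `|F x 0 i - ratr q| < k.+1%:R^-1.
    have [|q] := @rat_in_itvoo R (F x 0 i - k.+1%:R^-1) (F x 0 i + k.+1%:R^-1).
      by rewrite ltrBlDr -addrA ltrDl addr_gt0.
    rewrite in_itv /= => /andP[q1 q2]; exists q.
    by rewrite ltr_distlC ltrBlDr -ltrBlDr q1 q2.
  exists (\row_i sval (cid (dr i)), k) => //=.
  have Bx : B (\row_i sval (cid (dr i)), k) (F x).
    by move=> i /=; rewrite mxE; exact: (svalP (cid (dr i))).
  case: pselect => // -[z Bz]; apply: xO; split=> // a i; rewrite ord1 /=.
  rewrite /ball /= -[X in `|X|](subrKA (ratr ((\row_i sval (cid (dr i)) : 'rV_n) 0 i))).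
  rewrite (le_lt_trans (ler_normD _ _))// (splitr e) ltrD//.
    exact: lt_trans (Bx i) ke.
  by rewrite distrC; exact: lt_trans (Bz i) ke.
apply: countable_bigcupT_measurable; first exact: countableP.
move=> q; case: pselect => qO; last exact: measurable0.
rewrite (_ : _ @^-1` _ = \bigcap_(i in [set: 'I_n])
  ((fun x => F x 0 i) @^-1` ball (ratr (q.1 0 i) : R) q.2.+1%:R^-1)); last first.
  by apply/seteqP; split=> [x /= Bx i _|x /= Bx i];
    [rewrite /ball /= distrC|have := Bx i I; rewrite /ball /= distrC].
apply: fin_bigcap_measurable => // i _.
rewrite -[Y in measurable Y]setTI; apply: mF => //.
by apply: open_measurable; exact: ball_open.
Qed.

End Measurability.

(** * Volume on the sphere *)

Section ChartMeasure.
Variables (R : realType) (n : nat) (r : R).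
Hypothesis r0 : 0 < r.

Notation X := (n.-tuple (measurableTypeR R)).

Lemma measurable_rv i : measurable_fun setT (fun t : X => rv_of_tuple t 0 i : R).
Proof.
rewrite (_ : (fun t => _) = (fun t : X => tnth t i)); first exact: measurable_tnth.
by apply/funext => t; rewrite mxE.
Qed.

Lemma measurable_dot_rv :
  measurable_fun setT (fun t : X => dot (rv_of_tuple t) (rv_of_tuple t) : R).
Proof.
by apply: measurable_sum => i; apply: measurable_funM; exact: measurable_rv.
Qed.

Lemma measurable_conf : measurable_fun setT (fun t : X => conf (rv_of_tuple t) : R).
Proof.
(* the absolute value makes the outer function continuous on the whole line *)
pose g (z : R) : R := 2 / (1 + `|z|).
have mg : measurable_fun setT g.
  apply: continuous_measurable_fun => z; apply: cvgM; first exact: cvg_cst.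
  apply: cvgV; first by rewrite gt_eqF// ltr_pwDl.
  by apply: cvgD; [exact: cvg_cst|apply: cvg_norm; exact: cvg_id].
rewrite (_ : (fun t => _) = g \o (fun t : X => dot (rv_of_tuple t) (rv_of_tuple t))).
  exact: measurableT_comp mg measurable_dot_rv.
by apply/funext => t; rewrite /g /= ger0_norm ?dot_ge0.
Qed.

Lemma measurable_stereo s a :
  measurable_fun setT (fun t : X => stereo r s (rv_of_tuple t) 0 a : R).
Proof.
case: (unliftP ord0 a) => [b ->|->].
  under eq_fun do rewrite stereoS.
  apply: measurable_funM; last exact: measurable_rv.
  by apply: measurable_funM; [exact: measurable_cst|exact: measurable_conf].
under eq_fun do rewrite stereo0.
apply: measurable_funM; first exact: measurable_cst.
apply: measurable_funM; first exact: measurable_cst.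
by apply: measurable_funB; [exact: measurable_conf|exact: measurable_cst].
Qed.

Lemma measurable_density s :
  measurable_fun setT (fun t : X => vol_density r s (rv_of_tuple t) : R).
Proof.
under eq_fun do rewrite vol_density_conf//.
apply: measurable_funX.
by apply: measurable_funM; [exact: measurable_cst|exact: measurable_conf].
Qed.

Lemma enorm_lt1 m (y : 'rV[R]_m) : (enorm y < 1) = (dot y y < 1).
Proof. by rewrite -[X in _ < X]sqrtr1 ltr_sqrt. Qed.

Lemma measurable_chart_dom (Omega O : set 'rV[R]_n.+1) s : open O ->
  Omega = sphere r `&` O -> measurable (chart_dom r Omega s).
Proof.
move=> oO ->; rewrite (_ : chart_dom _ _ _ =
    (fun t : X => dot (rv_of_tuple t) (rv_of_tuple t)) @^-1` [set` `]-oo, 1[] `&`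
    (fun t : X => stereo r s (rv_of_tuple t)) @^-1` O).
  apply: measurableI.
    rewrite -[Y in measurable Y]setTI; apply: measurable_dot_rv => //.
  by apply: measurable_preimage_open => // i; exact: measurable_stereo.
apply/seteqP; split=> t; rewrite /chart_dom /= in_itv /= enorm_lt1.
  by move=> [? []].
by move=> [? ?]; split=> //; split=> //; exact: stereo_sphere.
Qed.

Lemma lebesgueRn_box (c : 'I_n -> R) (h : R) : 0 <= h ->
  lebesgueRn R n [set t | forall i, tnth t i \in `[c i - h, c i + h]] =
  ((2 * h) ^+ n)%:E.
Proof.
move=> h0.
pose A i : set (measurableTypeR R) := [set` `[c i - h, c i + h]].
have mA i : measurable (A i) by exact: measurable_itv.
rewrite [LHS](measure_power_box (@lebesgue_measure R) mA) /A.
rewrite (eq_bigr (fun=> (2 * h)%:E)) => [|i _]; last first.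
  rewrite [LHS](lebesgue_measure_itv `[c i - h, c i + h]) /= lte_fin.
  case: ltP => hh; first by rewrite EFinN -EFinB; congr (_%:E); ring.
  by congr (_%:E); apply/eqP; rewrite eq_le; apply/andP; split; lra.
by rewrite prodEFin prodr_const card_ord.
Qed.

Lemma measurable_lebesgueRn_box (c : 'I_n -> R) (h : R) :
  measurable [set t : X | forall i, tnth t i \in `[c i - h, c i + h]].
Proof.
exact: (@measurable_box _ (measurableTypeR R) n (fun i => [set` `[c i - h, c i + h]])).
Qed.

Section SphereIntegral.
Variables (Omega O : set 'rV[R]_n.+1).
Hypotheses (oO : open O) (OmegaE : Omega = sphere r `&` O).
Implicit Types (f g : 'rV[R]_n.+1 -> R) (P : pred 'rV[R]_n.+1).

Let mD s : measurable (chart_dom r Omega s).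
Proof. exact: measurable_chart_dom oO OmegaE. Qed.

Let density_ge0 s (y : 'rV[R]_n) : 0 <= vol_density r s y.
Proof. by rewrite vol_density_conf// exprn_ge0// mulr_ge0 ?ltW ?conf_gt0. Qed.

Lemma sphere_int_le f g : (forall x, Omega x -> f x <= g x) ->
  (forall x, Omega x -> 0 <= g x) ->
  (sphere_int r Omega f <= sphere_int r Omega g)%E.
Proof.
move=> fg g0; apply: lee_sum => s _; apply: le_integral_ge0r => t [_ Ot].
  by rewrite lee_fin ler_wpM2r ?fg.
by rewrite lee_fin mulr_ge0 ?g0.
Qed.

Lemma sphere_int_ge0 f : (forall x, Omega x -> 0 <= f x) ->
  (0 <= sphere_int r Omega f)%E.
Proof.
move=> f0; apply: sume_ge0 => s _; apply: integral_ge0 => t [_ Ot].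
by rewrite lee_fin mulr_ge0 ?f0.
Qed.

Definition chart_measurable P :=
  forall s, measurable [set t : X | P (stereo r s (rv_of_tuple t))].

Let ind P : 'rV[R]_n.+1 -> R := fun x => (P x)%:R.

Let measurable_ind s P : chart_measurable P -> measurable_fun setT
  (fun t : X => (ind P (stereo r s (rv_of_tuple t)) *
    vol_density r s (rv_of_tuple t))%:E).
Proof.
move=> mP; apply/measurable_EFinP/measurable_funM; last exact: measurable_density.
rewrite (_ : (fun t => _) = \1_[set t : X | P (stereo r s (rv_of_tuple t))]).
  exact: measurable_indic.
apply/funext => t; rewrite indicE /ind; congr (_%:R); congr nat_of_bool.
by apply/idP/idP; rewrite inE.
Qed.

Lemma sphere_int_indicators (I : finType) (a : I -> R) (P : I -> pred 'rV[R]_n.+1) :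
  (forall i, 0 <= a i) -> (forall i, chart_measurable (P i)) ->
  sphere_int r Omega (fun x => \sum_i a i * (P i x)%:R) =
  (\sum_i (a i)%:E * sphere_int r Omega (fun x => (P i x)%:R))%E.
Proof.
move=> a0 mP; rewrite /sphere_int.
transitivity (\sum_(s : bool) \sum_i (a i)%:E *
    \int[lebesgueRn R n]_(t in chart_dom r Omega s)
    (ind (P i) (stereo r s (rv_of_tuple t)) * vol_density r s (rv_of_tuple t))%:E)%E.
  apply: eq_bigr => s _; rewrite -[RHS]/(\sum_(i <- index_enum I) _)%E.
  under [RHS]eq_bigr => i _.
    rewrite -ge0_integralZl_EFin//; last 2 first.
      by move=> t _; rewrite lee_fin mulr_ge0 ?ler0n.
      by apply: measurable_funTS; exact: measurable_ind.
    over.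
  rewrite -ge0_integral_sum//; last 2 first.
    move=> i; apply: measurable_funTS.
    by apply: measurable_funeM; exact: measurable_ind.
    by move=> i t _; rewrite mule_ge0 ?lee_fin// mulr_ge0 ?ler0n.
  apply: eq_integral => t _; rewrite mulr_suml -sumEFin; apply: eq_bigr => i _.
  by rewrite -EFinM mulrA.
rewrite exchange_big; apply: eq_bigr => i _.
by rewrite ge0_sume_distrr// => s _; apply: integral_ge0 => t _;
  rewrite lee_fin mulr_ge0 ?ler0n.
Qed.

End SphereIntegral.
End ChartMeasure.

Section SphereVolume.
Variables (R : realType) (n : nat) (r : R).
Hypothesis r0 : 0 < r.
Variables (Omega O : set 'rV[R]_n.+1).
Hypotheses (oO : open O) (OmegaE : Omega = sphere r `&` O).

Notation X := (n.-tuple (measurableTypeR R)).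

Let mD s : measurable (chart_dom r Omega s).
Proof. exact: measurable_chart_dom oO OmegaE. Qed.

Let integral_box s (c : 'I_n -> R) (h k : R) : 0 <= k ->
  (\int[lebesgueRn R n]_(t in chart_dom r Omega s)
    (k * \1_[set t : X | forall i, tnth t i \in `[(c i - h)%R, (c i + h)%R]] t)%:E =
  k%:E * lebesgueRn R n
    ([set t : X | forall i, tnth t i \in `[(c i - h)%R, (c i + h)%R]] `&`
     chart_dom r Omega s))%E.
Proof.
move=> k0; have mb := measurable_lebesgueRn_box c h.
under eq_integral do rewrite EFinM.
rewrite ge0_integralZl_EFin//; first by rewrite integral_indic.
by apply: measurable_funTS; apply/measurable_EFinP; exact: measurable_indic.
Qed.

(** In either chart the set lies in a cube of half-width [2 e / r], and the
    density is at most [(2 r) ^+ n]. *)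
Lemma sphere_int_small (P : pred 'rV[R]_n.+1) (e : R) : 0 <= e ->
  (forall x y, P x -> P y -> forall a, `|x 0 a - y 0 a| <= e) ->
  (sphere_int r Omega (fun x => (P x)%:R) <= (2 * (8 * e) ^+ n)%:E)%E.
Proof.
move=> e0 Pe.
have H s : (\int[lebesgueRn R n]_(t in chart_dom r Omega s)
    ((P (stereo r s (rv_of_tuple t)))%:R * vol_density r s (rv_of_tuple t))%:E
    <= ((8 * e) ^+ n)%:E)%E.
  have [[t0 [D0 P0]]|nP] := pselect (exists t : X, chart_dom r Omega s t /\
      P (stereo r s (rv_of_tuple t))); last first.
    apply: (@le_trans _ _ 0%E); last by rewrite lee_fin exprn_ge0 ?mulr_ge0.
    rewrite -(integral0 (lebesgueRn R n) (chart_dom r Omega s)).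
    apply: le_integral_ge0r => // t Dt; rewrite lee_fin.
    case: (boolP (P _)) => Pt; last by rewrite mul0r.
    by case: nP; exists t.
  pose c i := rv_of_tuple t0 0 i.
  have k0 : 0 <= (2 * r) ^+ n by rewrite exprn_ge0// mulr_ge0// ltW.
  have h0 : 0 <= 2 * e / r by rewrite divr_ge0 ?mulr_ge0// ltW.
  apply: (@le_trans _ _ (\int[lebesgueRn R n]_(t in chart_dom r Omega s)
    ((2 * r) ^+ n * \1_[set t : X | forall i, tnth t i \in
      `[(c i - 2 * e / r)%R, (c i + 2 * e / r)%R]] t)%:E)%E).
    apply: le_integral_ge0r => t [t1 Ot]; last first.
      by rewrite lee_fin mulr_ge0// indicE ler0n.
    rewrite lee_fin; case: (boolP (P _)) => Pt; last first.
      by rewrite mul0r mulr_ge0// indicE ler0n.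
    rewrite indicE mem_set => [|i].
      have c0 := conf_gt0 (rv_of_tuple t).
      rewrite mul1r mulr1 vol_density_conf//.
      have c2 : r * conf (rv_of_tuple t) <= 2 * r by rewrite mulrC ler_pM2r// conf_le2.
      by apply: lerXn2r c2; rewrite nnegrE mulr_ge0// ltW.
    case: D0 => t01 _; move: t1 t01; rewrite /= !enorm_lt1 => /ltW t1 /ltW t01.
    have := stereo_inverse_lipschitz r0 t1 t01 (Pe _ _ Pt P0) i.
    have E : rv_of_tuple t 0 i = tnth t i by rewrite mxE.
    by rewrite distrC ler_distlC in_itv /= -E.
  rewrite integral_box//; apply: (@le_trans _ _ (((2 * r) ^+ n)%:E *
      ((2 * (2 * e / r)) ^+ n)%:E)%E).
    rewrite lee_wpmul2l ?lee_fin// -(lebesgueRn_box c h0).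
    apply: le_measure; rewrite ?inE; [|exact: measurable_lebesgueRn_box|].
      by apply: measurableI => //; exact: measurable_lebesgueRn_box.
    exact: subIsetl.
  rewrite -EFinM lee_fin -exprMn; apply: eq_ler.
  by congr (_ ^+ _); field; rewrite gt_eqF.
apply: (@le_trans _ _ (\sum_(s : bool) ((8 * e) ^+ n)%:E)%E).
  by apply: lee_sum => s _; exact: H.
by rewrite big_bool /= -EFinD lee_fin [2 * _ ^+ _]mulr_natl mulr2n.
Qed.

Lemma sphere_entry_le (x : 'rV[R]_n.+1) a : sphere r x -> `|x 0 a| <= r.
Proof.
move=> /(sphere_dot r0) xr.
rewrite -(ler_pXn2r (n := 2)) ?nnegrE ?(ltW r0)// real_normK ?num_real// -xr.
rewrite /dot (bigD1 a)//= -expr2 lerDl.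
by apply: sumr_ge0 => i _; rewrite -expr2 sqr_ge0.
Qed.

(** The whole sphere has diameter [2 r]. *)
Lemma sphere_int_volume_le :
  (sphere_int r Omega (fun=> 1%R) <= (2 * (16 * r) ^+ n)%:E)%E.
Proof.
have -> : 16 * r = 8 * (2 * r) by ring.
apply: (@le_trans _ _ (sphere_int r Omega (fun x =>
    ([pred x | `[< sphere r x >]] x)%:R))%E).
  apply: (sphere_int_le r0) => x; rewrite OmegaE => -[xr _] /=.
    by rewrite asboolT.
  by rewrite ler0n.
apply: sphere_int_small; first by rewrite mulr_ge0// ltW.
move=> x y /asboolP xr /asboolP yr a; apply: (le_trans (ler_normB _ _)).
by rewrite mulr_natl mulr2n lerD// sphere_entry_le.
Qed.

(** The chart is chosen by the sign of the first coordinate; the preimage then has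
    squared norm [(r - h) / (r + h)] with [h >= 0] the modulus of that
    coordinate. *)
Lemma stereo_surj (x : 'rV[R]_n.+1) : sphere r x ->
  exists s (y : 'rV[R]_n), dot y y <= 1 /\ stereo r s y = x.
Proof.
move=> xr; have xx := sphere_dot r0 xr.
pose s := x 0 ord0 < 0; pose h := (-1) ^+ s * x 0 ord0.
have h0 : 0 <= h.
  by rewrite /h /s; case: ltP => x0; rewrite ?expr1 ?expr0; lra.
have hE : x 0 ord0 = (-1) ^+ s * h.
  by rewrite /h mulrA -expr2 -exprM mulnC exprM sqrrN !expr1n mul1r.
have rh : 0 < r + h by rewrite ltr_pwDl.
pose y : 'rV[R]_n := \row_b (x 0 (lift ord0 b) / (r + h)).
have yy : dot y y = (r - h) / (r + h).
  have : x 0 ord0 * x 0 ord0 + \sum_b x 0 (lift ord0 b) * x 0 (lift ord0 b) = r ^+ 2.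
    by rewrite -xx /dot big_ord_recl.
  have -> : x 0 ord0 * x 0 ord0 = h ^+ 2.
    by rewrite hE; case: (s); rewrite ?expr1 ?expr0; ring.
  move=> /(canRL (addKr _)) S.
  rewrite /dot (eq_bigr (fun b => (x 0 (lift ord0 b) * x 0 (lift ord0 b)) *
    (r + h) ^- 2)) => [|b _]; last first.
    by rewrite !mxE; field; rewrite gt_eqF.
  by rewrite -mulr_suml S; field; rewrite gt_eqF.
have cy : r * conf y = r + h.
  rewrite /conf yy; field; rewrite !gt_eqF//= addrACA subrr addr0.
  by rewrite ?addr_gt0.
exists s, y; split.
  by rewrite yy ler_pdivrMr// mul1r; lra.
apply/rowP => a; case: (unliftP ord0 a) => [b ->|->].
  by rewrite stereoS cy mxE mulrC divfK// gt_eqF.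
by rewrite stereo0 mulrBr mulr1 cy addrAC subrr add0r -hE.
Qed.

(** A non-empty open set contains the image of a small cube of one chart. *)
Lemma sphere_int_volume_gt0 : Omega !=set0 ->
  (0 < sphere_int r Omega (fun=> 1%R))%E.
Proof.
move=> W0; have [x [xr Ox]] : (sphere r `&` O) !=set0 by rewrite -OmegaE.
have [s [y [y1 yx]]] := stereo_surj xr.
have cs : continuous (stereo r s : 'rV[R]_n -> _).
  by move=> z; apply: differentiable_continuous; exact: differentiable_stereo.
(* scaling [y] by a factor slightly below 1 leaves the closed ball for the
   open one without leaving the preimage of [O] *)
have [z [z1 Oz]] : exists z : 'rV[R]_n, dot z z < 1 /\ O (stereo r s z).
  have ct : (fun t : R => stereo r s (t *: y)) @ (1 : R)^'- --> x.
    have c1 : (fun t : R => t *: y) t @[t --> (1 : R)] --> 1 *: y.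
      by apply: cvgZr_tmp; exact: cvg_id.
    have := cvg_comp _ _ c1 (cs (1 *: y)).
    by rewrite scale1r yx; exact: cvg_at_left_filter.
  have [t [t0 [t1 Ot]]] : exists t : R, 0 < t /\ t < 1 /\ O (stereo r s (t *: y)).
    have F : \forall t \near (1 : R)^'-, O (stereo r s (t *: y)).
      by apply: ct; exact: open_nbhs_nbhs.
    near (1 : R)^'- => t; exists t; split; last split.
    - by near: t; apply: nbhs_left_gt.
    - by near: t; exact: nbhs_left_lt.
    - by near: t; exact: F.
  exists (t *: y); split=> //; rewrite dotZl dotZr.
  have ty : t * dot y y <= t by rewrite ler_piMr// ltW.
  apply: (@le_lt_trans _ _ (t * t)); first by rewrite ler_pM2l.
  by rewrite mulr_ilt1// ltW.
have oP : open [set z : 'rV[R]_n | dot z z < 1 /\ O (stereo r s z)].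
  apply: openI; last by apply: open_comp oO => z' _; exact: cs.
  apply: (@open_comp _ _ (fun z : 'rV[R]_n => dot z z) [set` `]-oo, 1[]) => [z' _|].
    by apply: (@cvg_dot _ _ _ (nbhs z') _ id id); exact: cvg_id.
  exact: interval_open.
have /nbhs_ballP[e /= e0 ze] : nbhs z [set z | dot z z < 1 /\ O (stereo r s z)].
  by apply: open_nbhs_nbhs; split.
pose h := e / 2; have h0 : 0 < h by rewrite divr_gt0.
pose box := [set t : X | forall i, tnth t i \in `[(z 0 i - h)%R, (z 0 i + h)%R]].
have boxD : box `<=` chart_dom r Omega s.
  move=> t bt; have [] : [set z | dot z z < 1 /\ O (stereo r s z)] (rv_of_tuple t).
    apply: ze; split=> // a i; rewrite ord1 /ball /= [rv_of_tuple t 0 i]mxE.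
    have := bt i; rewrite in_itv /= -ler_distlC => /le_lt_trans; apply.
    by rewrite /h ltr_pdivrMr// ltr_pMr// ltr1n.
  move=> t1 Ot; split; first by rewrite enorm_lt1.
  by rewrite OmegaE; split=> //; exact: stereo_sphere.
have rn0 : 0 < r ^+ n by rewrite exprn_gt0.
apply: (@lt_le_trans _ _ (\int[lebesgueRn R n]_(t in chart_dom r Omega s)
    (r ^+ n * \1_box t)%:E)%E).
  rewrite (integral_box s (fun i => z 0 i) h (ltW rn0)) -/box setIidl//.
  rewrite lebesgueRn_box ?(ltW h0)// -EFinM lte_fin mulr_gt0// exprn_gt0//.
  by rewrite mulr_gt0.
apply: (@le_trans _ _ (\int[lebesgueRn R n]_(t in chart_dom r Omega s)
    (1 * vol_density r s (rv_of_tuple t))%:E)%E).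
  apply: le_integral_ge0r => t [t1 _]; rewrite lee_fin mul1r vol_density_conf//.
    rewrite /= enorm_lt1 in t1; have c1 := conf_ge1 (ltW t1).
    apply: (@le_trans _ _ (r ^+ n)).
      by rewrite ler_piMr ?(ltW rn0)// indicE; case: (_ \in _).
    have rc : r <= r * conf (rv_of_tuple t) by rewrite ler_peMr// ltW.
    have rc0 := le_trans (ltW r0) rc.
    by apply: lerXn2r rc; rewrite nnegrE ?(ltW r0).
  by rewrite exprn_ge0// mulr_ge0 ?(ltW r0)// ltW// conf_gt0.
rewrite /sphere_int (bigD1 s)//=. apply: leeDl; apply: sume_ge0 => s' _.
apply: integral_ge0 => t _; rewrite lee_fin mul1r vol_density_conf//.
by rewrite exprn_ge0// mulr_ge0 ?(ltW r0)// ltW// conf_gt0.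
Unshelve. all: by end_near. Qed.

End SphereVolume.

(** * A pigeonhole argument *)

(** One colour class carries at least the fraction [1 / #|C|] of the total. In
    this class the indices with [s k > 2 #|C| q k] have total [q] at most
    [V / (2 #|C|)], since the [s k] of one colour sum to at most [V]; the others
    carry at least as much, and each of them at most [B]. *)
Lemma exists_good_colour (R : realFieldType) (K C : finType) (col : K -> C)
    (q s : K -> R) (V B : R) :
  0 < V -> (forall k, 0 <= q k) -> (forall k, q k <= B) -> (forall k, 0 <= s k) ->
  V <= \sum_k q k -> (forall c, \sum_(k | col k == c) s k <= V) ->
  exists c : C, V <=
    #|[pred k | [&& col k == c, 0 < q k & s k <= 2 * #|C|%:R * q k]]|%:R *
    (2 * #|C|%:R * B).
Proof.
move=> V0 q0 qB s0 Vq sV; set M : R := #|C|%:R.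
have M0 : 0 < M.
  rewrite ltr0n lt0n; apply: contraTN (lt_le_trans V0 Vq) => /eqP C0.
  rewrite -leNgt big1// => k _.
  by have := enum_rank (col k); rewrite C0 => -[].
have [c cV] : exists c, V / M <= \sum_(k | col k == c) q k.
  apply/existsP; apply: contraT; rewrite negb_exists => /forallP H.
  suff : \sum_k q k < V by rewrite ltNge Vq.
  rewrite (partition_big col predT)//=.
  have -> : V = \sum_(c : C) V / M.
    by rewrite sumr_const -mulr_natr -/M divfK ?gt_eqF.
  apply: ltr_sum => [|c _]; last by rewrite ltNge.
  have : (0 < #|C|)%N by rewrite -(ltr0n R).
  by case/card_gt0P => c _; apply/hasP; exists c; rewrite ?mem_index_enum.
exists c; set G := [pred k | _].
have GB : \sum_(k in G) q k <= #|G|%:R * B.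
  by rewrite mulr_natl -sumr_const; apply: ler_sum => k _.
have bad : \sum_(k | (col k == c) && (k \notin G)) q k <= V / (2 * M).
  apply: (@le_trans _ _ (\sum_(k | (col k == c) && (k \notin G)) s k / (2 * M))).
    apply: ler_sum => k /andP[kc]; rewrite inE kc /= negb_and.
    rewrite ler_pdivlMr ?mulr_gt0// -leNgt -ltNge [q k * _]mulrC => /orP[qk|/ltW//].
    by apply: (le_trans _ (s0 k)); rewrite pmulr_rle0// mulr_gt0.
  rewrite -mulr_suml ler_pM2r ?invr_gt0 ?mulr_gt0//; apply: le_trans (sV c).
  rewrite [leRHS](bigID (fun k => k \in G))/= lerDr.
  exact: sumr_ge0.
have split_c : \sum_(k | col k == c) q k =
    \sum_(k in G) q k + \sum_(k | (col k == c) && (k \notin G)) q k.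
  rewrite (bigID (fun k => k \in G))/=; congr (_ + _); apply: eq_bigl => k.
  by rewrite inE; case: (col k == c).
have : V / M - V / (2 * M) <= #|G|%:R * B.
  rewrite lerBlDr; apply: (le_trans cV); rewrite split_c; exact: lerD.
have -> : V / M - V / (2 * M) = V / (2 * M) by field; rewrite gt_eqF.
rewrite ler_pdivrMr ?mulr_gt0//.
by move=> H; apply: le_trans H _; apply: eq_ler; ring.
Qed.

(** * Test families for the min-max formula *)

Lemma fine_le_ge0 (R : realType) (x : \bar R) (a : R) :
  0 <= a -> (x <= a%:E)%E -> fine x <= a.
Proof. by case: x => [y| |] a0; rewrite ?lee_fin ?leye_eq. Qed.

Lemma fine_ge_fin (R : realType) (x : \bar R) (a b : R) :
  (a%:E <= x)%E -> (x <= b%:E)%E -> a <= fine x.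
Proof. by case: x => [y| |]; rewrite ?lee_fin ?leye_eq ?leeNy_eq. Qed.

Section WeightsOfSets.
Variables (R : realType) (n : nat) (r : R).
Hypothesis r0 : 0 < r.
Variables (Omega O : set 'rV[R]_n.+1).
Hypotheses (oO : open O) (OmegaE : Omega = sphere r `&` O).

Let w (P : pred 'rV[R]_n.+1) : \bar R := sphere_int r Omega (fun x => (P x)%:R).

Lemma measurable_gap (b T : R) (p' : 'rV[R]_n.+1) :
  chart_measurable r (fun x => 0 < gap b T p' x).
Proof.
move=> s; rewrite (_ : [set _ | _] = (fun t : n.-tuple (measurableTypeR R) =>
    gap b T p' (stereo r s (rv_of_tuple t))) @^-1` [set` `]0, +oo[]).
  rewrite -[Y in measurable Y]setTI.
  suff : measurable_fun setT (fun t : n.-tuple (measurableTypeR R) =>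
      gap b T p' (stereo r s (rv_of_tuple t))) by apply => //.
  apply: measurable_funB; first exact: measurable_cst.
  apply: measurable_funM; first exact: measurable_cst.
  have mc a : measurable_fun setT (fun t : n.-tuple (measurableTypeR R) =>
      (stereo r s (rv_of_tuple t) - p') 0 a : R).
    rewrite (_ : (fun t => _) = fun t => stereo r s (rv_of_tuple t) 0 a - p' 0 a).
      by apply: measurable_funB; [exact: measurable_stereo|exact: measurable_cst].
    by apply/funext => t; rewrite mxE [X in _ + X]mxE.
  by apply: measurable_sum => a; apply: measurable_funM.
by apply/seteqP; split=> t /=; rewrite in_itv /= andbT.
Qed.

Lemma sphere_int_pred_ge0 P : (0 <= w P)%E.
Proof. by apply: (sphere_int_ge0 r0) => x _; rewrite ler0n. Qed.

Lemma sphere_int_pred_fin P : w P \is a fin_num.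
Proof.
rewrite ge0_fin_numE ?sphere_int_pred_ge0//; apply: (@le_lt_trans _ _ (2 * (16 * r) ^+ n)%:E).
  apply: le_trans (sphere_int_volume_le r0 oO OmegaE).
  by apply: (sphere_int_le r0) => // x _; rewrite lern1 leq_b1.
exact: ltry.
Qed.

Lemma sphere_int_weighted (I : finType) (a : I -> R)
    (P : I -> pred 'rV[R]_n.+1) :
  (forall i, 0 <= a i) -> (forall i, chart_measurable r (P i)) ->
  sphere_int r Omega (fun x => \sum_i a i * (P i x)%:R) =
  (\sum_i a i * fine (w (P i)))%:E.
Proof.
move=> a0 mP; rewrite (sphere_int_indicators r0 oO OmegaE)// -sumEFin.
by apply: eq_bigr => i _; rewrite EFinM fineK// sphere_int_pred_fin.
Qed.

End WeightsOfSets.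

Section TestFamily.
Variables (R : realType) (n : nat) (r b T : R).
Hypotheses (r0 : 0 < r) (T1 : 1 <= T) (br1 : 1 <= b * r ^+ 2).
Variables (Omega O : set 'rV[R]_n.+1).
Hypotheses (oO : open O) (OmegaE : Omega = sphere r `&` O).
Variables (j : nat) (p : 'I_j -> 'rV[R]_n.+1) (Q : 'I_j -> pred 'rV[R]_n.+1).

Let act i : pred 'rV[R]_n.+1 := fun x => 0 < gap b T (p i) x.
Let w (P : pred 'rV[R]_n.+1) : \bar R := sphere_int r Omega (fun x => (P x)%:R).

Hypothesis gapQ : forall i x, Q i x -> 1 <= gap b T (p i) x.
Hypothesis mQ : forall i, chart_measurable r (Q i).
Hypothesis act_inj : forall x i k, act i x -> act k x -> i = k.

Let norm_const_ge0 : 0 <= norm_const n b T.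
Proof.
have b0 : 0 <= b.
  have r2 : 0 < r ^+ 2 by rewrite exprn_gt0.
  by rewrite -(pmulr_lge0 _ r2); apply: le_trans br1.
have T0 : 0 <= T by apply: le_trans T1.
by rewrite /norm_const !addr_ge0 ?mulr_ge0 ?sqr_ge0 ?expR_ge0.
Qed.

Let energy_const_ge0 : 0 <= energy_const n T.
Proof.
have T0 : 0 <= T by apply: le_trans T1.
by rewrite /energy_const addr_ge0 ?mulr_ge0 ?sqr_ge0 ?expR_ge0.
Qed.

Section Combination.
Variable c : 'I_j -> R.

Let u x := \sum_i c i * cutoff b T (p i) x.
Let mass_act := \sum_i c i ^+ 2 * fine (w (act i)).
Let mass_Q := \sum_i c i ^+ 2 * fine (w (Q i)).

Let sphere_Omega x : Omega x -> sphere r x.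
Proof. by rewrite OmegaE => -[]. Qed.

Let upper f k : 0 <= k ->
  (forall x, sphere r x -> f x <= k * \sum_i c i ^+ 2 * (act i x)%:R) ->
  (sphere_int r Omega f <= (k * mass_act)%:E)%E.
Proof.
move=> k0 fk; apply: (@le_trans _ _ (sphere_int r Omega (fun x =>
    \sum_i k * c i ^+ 2 * (act i x)%:R))).
  apply: (sphere_int_le r0) => x Ox.
    apply: le_trans (fk x (sphere_Omega Ox)) _.
    by rewrite mulr_sumr; apply: ler_sum => i _; rewrite mulrA.
  by apply: sumr_ge0 => i _; rewrite mulr_ge0 ?ler0n// mulr_ge0 ?sqr_ge0.
rewrite (sphere_int_weighted r0 oO OmegaE) => [|i|i].
    by rewrite lee_fin mulr_sumr; apply: ler_sum => i _; rewrite -mulrA.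
  by rewrite mulr_ge0 ?sqr_ge0.
exact: measurable_gap.
Qed.

Let lower f : (forall x, sphere r x -> u x ^+ 2 <= f x) ->
  (mass_Q%:E <= sphere_int r Omega f)%E.
Proof.
move=> uf; rewrite -(sphere_int_weighted r0 oO OmegaE)//; last by move=> i; exact: sqr_ge0.
apply: (sphere_int_le r0) => x /sphere_Omega xr; last first.
  by apply: le_trans (uf x xr); exact: sqr_ge0.
apply: le_trans (uf x xr).
apply: le_trans (sqr_cutoff_ge c (@act_inj x)).
apply: ler_sum => i _; rewrite ler_wpM2l ?sqr_ge0// ler_nat.
by case: (boolP (Q i x)) => // /gapQ ->.
Qed.

Let mass_act_ge0 : 0 <= mass_act.
Proof. by apply: sumr_ge0 => i _; rewrite mulr_ge0 ?sqr_ge0// fine_ge0// sphere_int_pred_ge0. Qed.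

Lemma h2_normsq_cutoff_le :
  (h2_normsq r Omega u <= (norm_const n b T * mass_act)%:E)%E.
Proof.
by apply: upper => // x xr; apply: norm_density_le => // i k; exact: act_inj.
Qed.

Lemma h2_normsq_cutoff_ge : (mass_Q%:E <= h2_normsq r Omega u)%E.
Proof.
apply: lower => x xr; rewrite lerDr addr_ge0 ?dot_ge0//.
by do 2![apply: sumr_ge0 => ? _]; exact: sqr_ge0.
Qed.

Lemma energy_cutoff_le :
  fine (sphere_int r Omega (fun x =>
    hess_normsq r u x + ric r x (grad r u x) (grad r u x))) <=
  energy_const n T * b ^+ 2 * mass_act.
Proof.
have kb : 0 <= energy_const n T * b ^+ 2 := mulr_ge0 energy_const_ge0 (sqr_ge0 b).
apply: fine_le_ge0; first exact: mulr_ge0.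
apply: upper => // x xr.
by apply: energy_density_le => // i k; exact: act_inj.
Qed.

Lemma mass_cutoff_ge :
  mass_Q <= fine (sphere_int r Omega (fun x => u x ^+ 2)).
Proof.
apply: (fine_ge_fin (b := expR 1 ^+ 2 * mass_act)); first exact: lower.
apply: upper => [|x xr]; first exact: sqr_ge0.
by apply: sqr_cutoff_le => i k; exact: act_inj.
Qed.

End Combination.

Let U : 'I_j -> nat -> 'rV[R]_n.+1 -> R := fun i _ => cutoff b T (p i).

Let H2_norm_cst (u : 'rV[R]_n.+1 -> R) :
  H2_norm r Omega (fun=> u) = h2_norm r Omega u.
Proof. exact: lim_cst. Qed.

Let energy_cst (u : 'rV[R]_n.+1 -> R) :
  energy r Omega (fun=> u) = fine (sphere_int r Omega (fun x =>
    hess_normsq r u x + ric r x (grad r u x) (grad r u x))).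
Proof. exact: lim_cst. Qed.

Let mass_cst (u : 'rV[R]_n.+1 -> R) :
  mass r Omega (fun=> u) = fine (sphere_int r Omega (fun x => u x ^+ 2)).
Proof. exact: lim_cst. Qed.

(** A combination with zero norm has zero mass, and its mass is at least
    [\sum_k c k ^+ 2 * w (Q k)] with positive weights. *)
Lemma H2_free_cutoff : (forall i, 0 < fine (w (Q i))) -> H2_free r Omega U.
Proof.
move=> Q0; split=> [i|c].
  have UE : cutoff b T (p i) = fun x => \sum_k (k == i)%:R * cutoff b T (p k) x.
    apply/funext => x; rewrite (bigD1 i)//= eqxx mul1r big1 ?addr0// => k ki.
    by rewrite (negbTE ki) mul0r.
  split=> [k|e e0].
    split; first by rewrite /U UE; exact: smooth_cutoff.
    by rewrite /U UE (le_lt_trans (h2_normsq_cutoff_le _))// ltry.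
  exists 0%N => k l _ _; rewrite /U.
  have -> : (fun x => cutoff b T (p i) x - cutoff b T (p i) x) =
      fun x => \sum_k 0 * cutoff b T (p k) x.
    by apply/funext => x; rewrite subrr big1// => m _; rewrite mul0r.
  rewrite /h2_norm ler0_sqrtr//; apply: fine_le_ge0 => //.
  apply: le_trans (h2_normsq_cutoff_le _) _.
  by rewrite big1 ?mulr0// => m _; rewrite expr0n mul0r.
rewrite (H2_norm_cst (fun x => \sum_i c i * cutoff b T (p i) x)) => /eqP.
rewrite sqrtr_eq0 => nc i.
have := fine_ge_fin (h2_normsq_cutoff_ge c) (h2_normsq_cutoff_le c).
move=> /le_trans /(_ nc) S0.
have t0 k : 0 <= c k ^+ 2 * fine (w (Q k)) by rewrite mulr_ge0 ?sqr_ge0 ?ltW.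
have : c i ^+ 2 * fine (w (Q i)) <= 0.
  apply: le_trans S0; rewrite [leRHS](bigD1 i)//= lerDl; exact: sumr_ge0.
by rewrite pmulr_lle0// => ci; apply/eqP; rewrite -sqrf_eq0 eq_le ci sqr_ge0.
Qed.

(** Because the supports are disjoint, energy and mass are bounded by sums of
    squares of the coefficients, which are compared term by term. *)
Lemma neumann_mu_le (L : R) : 0 <= L ->
  (forall i, 0 < fine (w (Q i))) ->
  (forall i, fine (w (act i)) <= L * fine (w (Q i))) ->
  (neumann_mu r Omega j <= (energy_const n T * b ^+ 2 * L)%:E)%E.
Proof.
move=> L0 Q0 QL.
have C0 : 0 <= energy_const n T * b ^+ 2 := mulr_ge0 energy_const_ge0 (sqr_ge0 b).
apply: ereal_inf_le; eexists.
  by exists U; [exact: H2_free_cutoff|reflexivity].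
apply: ge_ereal_sup => _ [c [i ci] ->]; rewrite lee_fin.
pose u x := \sum_k c k * cutoff b T (p k) x.
rewrite (energy_cst u) (mass_cst u).
have E := energy_cutoff_le c; have M := mass_cutoff_ge c.
have m0 : 0 < \sum_k c k ^+ 2 * fine (w (Q k)).
  rewrite (bigD1 i)//= ltr_pwDl//.
    by rewrite mulr_gt0// lt_neqAle sqr_ge0 eq_sym sqrf_eq0 ci.
  by apply: sumr_ge0 => k _; rewrite mulr_ge0 ?sqr_ge0 ?ltW.
rewrite ler_pdivrMr ?(lt_le_trans m0)//.
apply: (le_trans E); rewrite -[leRHS]mulrA ler_wpM2l//.
apply: (@le_trans _ _ (L * \sum_k c k ^+ 2 * fine (w (Q k)))).
  rewrite mulr_sumr; apply: ler_sum => k _.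
  by rewrite mulrCA ler_wpM2l ?sqr_ge0.
by rewrite ler_wpM2l.
Qed.

End TestFamily.

(** * A cubic grid in the ambient space *)

Section CubicGrid.
Variables (R : realType) (n : nat) (r delta : R).
Hypotheses (r0 : 0 < r) (d0 : 0 < delta).

(** The cells indexed by [0, ..., side_count] in every direction, starting from
    [- r], cover the cube [[-r, r]^(n+1)]. *)
Definition side_count : nat := Num.truncn (2 * r / delta).

Notation index := {ffun 'I_n.+1 -> 'I_side_count.+1}.
Notation colour := {ffun 'I_n.+1 -> 'I_(2 * n + 3).+1}.
Implicit Types (k : index) (x : 'rV[R]_n.+1).

Definition corner k : 'rV[R]_n.+1 := \row_a (delta * (k a)%:R - r).

Definition cell k : pred 'rV[R]_n.+1 :=
  fun x => [forall a, corner k 0 a <= x 0 a < corner k 0 a + delta].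

(** The modulus is twice the half-width [n + 2] of a support, in units of
    [delta]. *)
Definition residue k : colour := [ffun a => inord (k a %% (2 * n + 3).+1)].

Let b : R := delta^-1 ^+ 2.
Let T : R := n.+2%:R.

Lemma cell_small k x y a : cell k x -> cell k y -> `|x 0 a - y 0 a| <= delta.
Proof.
move=> /forallP/(_ a)/andP[x1 x2] /forallP/(_ a)/andP[y1 y2].
by rewrite ler_distlC; apply/andP; split; lra.
Qed.

Lemma cell_cover x : sphere r x -> exists k, cell k x.
Proof.
move=> xr.
have xa a : 0 <= (x 0 a + r) / delta.
  have := sphere_entry_le r0 a xr; rewrite ler_norml => /andP[x1 _].
  by rewrite divr_ge0 ?(ltW d0)//; lra.
have kN a : (Num.truncn ((x 0 a + r) / delta)%R < side_count.+1)%N.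
  rewrite ltnS; apply: le_truncn.
  have := sphere_entry_le r0 a xr; rewrite ler_norml => /andP[_ x1].
  by rewrite ler_pM2r ?invr_gt0//; lra.
exists [ffun a => Ordinal (kN a)]; apply/forallP => a; rewrite mxE ffunE /=.
have /andP[] := truncn_itv (xa a); set i := Num.truncn _.
rewrite ler_pdivlMr// ltr_pdivrMr// -natr1 => t1 t2.
by apply/andP; split; lra.
Qed.

(** The squared diameter of a cell is [(n + 1) delta ^+ 2]. *)
Lemma gap_cell k x : cell k x -> 1 <= gap b T (corner k) x.
Proof.
move=> /forallP kx; rewrite /gap lerBrDr -lerBrDl.
have -> : T - 1 = n.+1%:R by rewrite /T -natr1 addrK.
rewrite mulrC /b exprVn ler_pdivrMr ?exprn_gt0//.
rewrite mulr_natl -[X in _ *+ X]card_ord -sumr_const; apply: ler_sum => a _.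
have /andP[x1 x2] := kx a.
rewrite mxE [X in _ + X]mxE expr2; apply: ler_pM => //; lra.
Qed.

Lemma gap_close k x a : 0 < gap b T (corner k) x ->
  `|x 0 a - corner k 0 a| < T * delta.
Proof.
have T1 : 1 <= T by rewrite ler1n.
rewrite subr_gt0 /b exprVn mulrC ltr_pdivrMr ?exprn_gt0// => D.
have Td0 : 0 <= T * delta by rewrite mulr_ge0 ?ler0n ?(ltW d0).
rewrite -(ltr_pXn2r (n := 2)) ?nnegrE// real_normK ?num_real//.
apply: (@le_lt_trans _ _ (dot (x - corner k) (x - corner k))).
  have E : (x - corner k) 0 a = x 0 a - corner k 0 a.
    by rewrite [LHS]mxE [X in _ + X = _]mxE.
  rewrite /dot (bigD1 a)//= E -expr2 lerDl.
  by apply: sumr_ge0 => i _; rewrite -expr2 sqr_ge0.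
apply: (lt_le_trans D); rewrite exprMn ler_pM2r ?exprn_gt0//.
by rewrite expr2 ler_peMl.
Qed.

(** Two corners whose indices agree modulo [2 (n + 2)] but differ are at least
    [2 (n + 2) delta] apart in some coordinate, so the two supports, of
    half-width [(n + 2) delta], do not meet. *)
Lemma gap_disjoint k k' x : residue k = residue k' ->
  0 < gap b T (corner k) x -> 0 < gap b T (corner k') x -> k = k'.
Proof.
move=> kk' gk gk'; apply/ffunP => a; apply/val_inj => /=.
have /(congr1 val) : residue k a = residue k' a by rewrite kk'.
rewrite !ffunE /= !inordK ?ltn_pmod//.
have := gap_close a gk; have := gap_close a gk'.
rewrite ![corner _ 0 a]mxE; set i : nat := k a; set i' : nat := k' a.
rewrite !ltr_distl => /andP[u1 u2] /andP[v1 v2] Em.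
have L (p q : nat) : (p = q %[mod (2 * n + 3).+1])%N -> (p <= q)%N ->
    delta * q%:R < delta * p%:R + 2 * T * delta -> p = q.
  move=> Em' pq H; apply/eqP; rewrite eqn_leq pq /=.
  have : (q - p < (2 * n + 3).+1)%N.
    rewrite -(ltr_nat R) natrB// ltrBlDl.
    rewrite -(ltr_pM2l d0) mulrDr; apply: (lt_le_trans H).
    rewrite lerD2l; apply: eq_ler.
    by rewrite /T -!natr1 natrD natrM; ring.
  move: Em' => /eqP; rewrite eq_sym eqn_mod_dvd// => /dvdn_leq dv lt.
  rewrite -subn_eq0; move: dv lt; case: (q - p)%N => // s /(_ isT) dv.
  by rewrite ltnNge dv.
have [ii|ii] := leqP i i'; first by apply: L => //; lra.
by apply/esym/L => //; [exact: ltnW|lra].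
Qed.

Lemma measurable_cell k : chart_measurable r (cell k).
Proof.
move=> s; rewrite (_ : [set _ | _] = \bigcap_(a in [set: 'I_n.+1])
  ((fun t : n.-tuple (measurableTypeR R) => stereo r s (rv_of_tuple t) 0 a) @^-1`
    [set` `[corner k 0 a, corner k 0 a + delta[])); last first.
  apply/seteqP; split=> t /=.
    by move=> /forallP kt a _; rewrite /= in_itv /=; exact: kt.
  by move=> kt; apply/forallP => a; have := kt a I; rewrite /= in_itv.
apply: fin_bigcap_measurable => // a _.
rewrite -[Y in measurable Y]setTI; apply: measurable_stereo => //.
Qed.

Lemma card_colour : #|{: colour}| = ((2 * n + 3).+1 ^ n.+1)%N.
Proof. by rewrite card_ffun !card_ord. Qed.

End CubicGrid.

(** * The eigenvalue bound *)

(** Each good cell has volume at most [2 (8 delta) ^+ n], so the assumption on [j]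
    says that at least [j] of them exist. *)
Lemma neumann_mu_le_grid (R : realType) (n : nat) (r delta : R)
    (Omega O : set 'rV[R]_n.+1) (j : nat) (M := ((2 * n + 3).+1 ^ n.+1)%N) :
  0 < r -> 0 < delta -> delta <= r -> open O -> Omega = sphere r `&` O ->
  0 < volume r Omega ->
  j%:R * (2 * M%:R * (2 * (8 * delta) ^+ n)) <= volume r Omega ->
  (neumann_mu r Omega j <=
    (energy_const n n.+2%:R * delta^-1 ^+ 4 * (2 * M%:R))%:E)%E.
Proof.
move=> r0 d0 dr oO OmegaE V0 jV; set V := volume r Omega in V0 jV.
pose b : R := delta^-1 ^+ 2; pose T : R := n.+2%:R.
have T1 : 1 <= T by rewrite ler1n.
have br1 : 1 <= b * r ^+ 2.
  by rewrite /b exprVn mulrC ler_pdivlMr ?exprn_gt0// mul1r lerXn2r// nnegrE ltW.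
pose K := {ffun 'I_n.+1 -> 'I_(side_count r delta).+1}.
pose act (k : K) : pred 'rV[R]_n.+1 := fun x => 0 < gap b T (corner k) x.
pose w (P : pred 'rV[R]_n.+1) := fine (sphere_int r Omega (fun x => (P x)%:R)).
have w0 P : 0 <= w P by apply: fine_ge0; exact: sphere_int_pred_ge0.
have Vfin := sphere_int_volume_le r0 oO OmegaE.
have wq (k : K) : w (cell k) <= 2 * (8 * delta) ^+ n.
  apply: fine_le_ge0; first by rewrite mulr_ge0// exprn_ge0// mulr_ge0// ltW.
  apply: (sphere_int_small r0 oO OmegaE); first exact: ltW.
  by move=> x y kx ky a; exact: (cell_small a kx ky).
have Vq : V <= \sum_(k : K) w (cell k).
  apply: fine_le_ge0; first by apply: sumr_ge0 => k _; exact: w0.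
  have := sphere_int_weighted r0 oO OmegaE (a := fun _ : K => 1)
    (fun=> ler01) (@measurable_cell R n r delta).
  under eq_bigr do rewrite mul1r.
  move=> <-; apply: (sphere_int_le r0) => x; rewrite OmegaE => -[xr _].
    have [k kx] := cell_cover r0 d0 xr.
    by rewrite (bigD1 k)//= kx mul1r lerDl sumr_ge0// => i _; rewrite mul1r ler0n.
  by apply: sumr_ge0 => i _; rewrite mul1r ler0n.
have sV c : \sum_(k : K | residue k == c) w (act k) <= V.
  apply: fine_ge_fin Vfin; rewrite big_mkcond /=.
  have := sphere_int_weighted r0 oO OmegaE (a := fun k : K => (residue k == c)%:R)
    (fun k => ler0n _ _) (fun k => measurable_gap r b T (corner k)).
  rewrite (eq_bigr (fun k : K => if residue k == c then w (act k) else 0)); last first.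
    by move=> k _; case: (residue k == c); rewrite ?mul1r ?mul0r.
  move=> <-; apply: (sphere_int_le r0) => // x _.
  apply: (@sum_disjoint_ind _ (fun k : K => (residue k == c) && act k x) _ R
    (fun s : R => s <= 1)).
  - move=> k k' /andP[/eqP kc ak] /andP[/eqP kc' ak'].
    by apply: (gap_disjoint d0 _ ak ak'); rewrite kc.
  - move=> k; case: (residue k == c) => [/negbTE nk|_]; last by rewrite mul0r.
    by rewrite -/(act k x) [act k x]nk mulr0.
  - exact: ler01.
  by move=> k /andP[-> ak]; rewrite mul1r lern1 leq_b1.
have [c] := exists_good_colour V0 (fun k => w0 (cell k)) wq (fun k => w0 (act k)) Vq sV.
rewrite card_colour -/M; set G := [pred k | _] => VG.
have M0 : (0 < M)%N by rewrite expn_gt0.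
have jG : (j <= #|G|)%N.
  have B0 : 0 < 2 * M%:R * (2 * (8 * delta) ^+ n) :> R.
    by rewrite !mulr_gt0 ?ltr0n// exprn_gt0// mulr_gt0.
  by rewrite -(ler_nat R) -(ler_pM2r B0); exact: le_trans VG.
pose f (i : 'I_j) : K := enum_val (widen_ord jG i).
have fG i : [&& residue (f i) == c, 0 < w (cell (f i)) &
    w (act (f i)) <= 2 * M%:R * w (cell (f i))].
  by have := enum_valP (widen_ord jG i); rewrite inE.
have -> : delta^-1 ^+ 4 = b ^+ 2 by rewrite -exprM.
have f_inj : injective f.
  by move=> i k /enum_val_inj /(congr1 val) ik; exact/val_inj.
apply: (neumann_mu_le (p := fun i => corner (f i)) (Q := fun i => cell (f i))
  r0 T1 br1 oO OmegaE).
- by move=> i x; exact: gap_cell.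
- by move=> i; exact: measurable_cell.
- move=> x i k ai ak; apply: f_inj; apply: gap_disjoint ai ak => //.
  by have /and3P[/eqP -> _ _] := fG i; have /and3P[/eqP -> _ _] := fG k.
- by rewrite mulr_ge0 ?ler0n.
- by move=> i; have /and3P[_ ? _] := fG i.
- by move=> i; have /and3P[_ _ ?] := fG i.
Qed.

Theorem theorem5p15 (R : realType) (n : nat) (hn : (0 < n)%N) :
  exists A : R, forall (r : R) (Omega : set 'rV[R]_n.+1),
    0 < r -> domain r Omega -> C1_boundary r Omega ->
    forall j : nat, (0 < j)%N ->
      (neumann_mu r Omega j <=
        (A * (j%:R / volume r Omega) `^ (4%:R / n%:R))%:E)%E.
Proof.
pose M : nat := ((2 * n + 3).+1 ^ n.+1)%N.
pose D : R := 4 * M%:R * 8 ^+ n.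
exists (energy_const n n.+2%:R * D `^ (4 / n%:R) * (2 * M%:R)).
move=> r Omega r0 [W0 _ [B oO OmegaE]] _ j j0.
have V0' := sphere_int_volume_gt0 r0 oO OmegaE W0.
have Vle := sphere_int_volume_le r0 oO OmegaE.
have V0 : 0 < volume r Omega.
  by rewrite fine_gt0// V0' (le_lt_trans Vle)// ltry.
have Vr : volume r Omega <= 2 * (16 * r) ^+ n.
  apply: fine_le_ge0 Vle; by rewrite mulr_ge0// exprn_ge0// mulr_ge0// ltW.
set V := volume r Omega in V0 Vr *.
have M0 : (0 < M)%N by rewrite expn_gt0.
have D0 : 0 < D by rewrite !mulr_gt0 ?ltr0n// exprn_gt0.
have jR : 0 < j%:R :> R by rewrite ltr0n.
have nR : n%:R != 0 :> R by rewrite pnatr_eq0 -lt0n.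
(* [w] is the inverse of the side of the grid: [D] is chosen so that the lower
   bound for the number of good cells at this scale is exactly [j] *)
pose x : R := j%:R * D / V.
have x0 : 0 < x by rewrite divr_gt0// mulr_gt0.
pose w := x `^ n%:R^-1.
have w0 : 0 < w by rewrite powR_gt0.
have wn : w ^+ n = x by rewrite -powR_mulrn ?powR_ge0// -powRrM mulVf// powRr1// ltW.
have w4 : w ^+ 4 = D `^ (4 / n%:R) * (j%:R / V) `^ (4 / n%:R).
  rewrite -powR_mulrn ?powR_ge0// -powRrM -powRM ?(ltW D0) ?divr_ge0 ?(ltW V0)//.
  by rewrite [n%:R^-1 * _]mulrC; congr (_ `^ _); rewrite /x; ring.
have rw : w^-1 <= r.
  rewrite -[leRHS]invrK lef_pV2 ?posrE ?invr_gt0//.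
  rewrite -(ler_pXn2r (n := n)) ?nnegrE ?invr_ge0 ?(ltW r0) ?(ltW w0)// wn.
  rewrite exprVn /x ler_pdivlMr// mulrC ler_pdivrMr ?exprn_gt0//.
  apply: (le_trans Vr); rewrite exprMn mulrA ler_pM2r ?exprn_gt0//.
  have M2 : 2 ^+ n <= M%:R :> R.
    rewrite -natrX ler_nat (@leq_trans (2 ^ n.+1)) ?leq_pexp2l// leq_exp2r//.
    by rewrite addnC.
  have -> : 16 = 2 * 8 :> R by ring.
  rewrite exprMn mulrA; apply: (@le_trans _ _ D).
    rewrite ler_pM2r ?exprn_gt0//; apply: ler_pM => //.
    by rewrite ler_nat.
  by rewrite ler_peMl ?(ltW D0)// ler1n.
have jV : j%:R * (2 * M%:R * (2 * (8 * w^-1) ^+ n)) <= V.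
  rewrite exprMn exprVn wn /x.
  apply: eq_ler; rewrite /D; field.
  by rewrite !gt_eqF ?exprn_gt0 ?ltr0n.
have iw0 : 0 < w^-1 by rewrite invr_gt0.
have := neumann_mu_le_grid r0 iw0 rw oO OmegaE V0 jV.
rewrite invrK w4 => /le_trans; apply; rewrite lee_fin.
by apply: eq_ler; ring.
Qed.
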